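(* Let $\mu_0\in\mathcal A$. Let $\omega(t)$ be a solution to $$\frac{d}{dt}\omega=-(\rho^{B})^{1,1}(\omega),\qquad \omega(0)=\omega_0,$$ in the space of $J_0$-compatible forms on $\mathbb R^{2n}$ (where $\rho^B(\omega)$ is computed with respect to the bracket $\mu_0$), and let $\mu(t)$ be a solution to the bracket flow $$\frac{d}{dt}\mu=\tfrac12\,\delta_{\mu}(P_{\mu}),\qquad \mu(0)=\mu_0 .$$ Then there exists a curve $h=h(t)\in \mathrm{GL}(n,\mathbb C)$ such that (for all $t$ in a common interval of definition containing $0$): 1. $\omega=h^*\omega_0$; 2. $\mu=h\cdot\mu_0$; 3. $\frac{d}{dt}h=-\frac12\,h\,P(\omega)=-\frac12\,P_{\mu}\,h$.
   Context: $\mathbb R^{2n}$ carries its standard Hermitian structure: complex structure $J_0$, inner product $\langle\cdot,\cdot\rangle$, and fundamental form $\omega_0(X,Y)=\langle X,J_0Y\rangle$. $\mathrm{GL}(n,\mathbb C)$ is the group of invertible real-linear maps of $\mathbb R^{2n}$ commuting with $J_0$. $V=\Lambda^2(\mathbb R^{2n})^*\otimes\mathbb R^{2n}$, and $\mathcal A$ is the set of $\mu\in V$ that satisfy the Jacobi identity and $\mu(J_0X,J_0Y)-J_0\mu(J_0X,Y)-J_0\mu(X,J_0Y)-\mu(X,Y)=0$ for all $X,Y$; thus $(\mathbb R^{2n},\mu,J_0)$ is a Lie algebra with a complex structure. A 2-form $\omega$ is $J_0$-compatible if $\omega(J_0\cdot,J_0\cdot)=\omega$ and $g(X,Y):=\omega(J_0X,Y)$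 is an inner product; equivalently $\omega(X,Y)=g(X,J_0Y)$. For $\mu\in\mathcal A$ and a $J_0$-compatible $\omega$ with inner product $g$, the Bismut connection is the unique bilinear map $(X,Y)\mapsto\nabla^B_XY$ such that $g(\nabla^B_XY,Z)+g(Y,\nabla^B_XZ)=0$, $\nabla^B_X J_0=J_0\nabla^B_X$, and $c(X,Y,Z)=g(X,T^B(Y,Z))$ is alternating, where $T^B(X,Y)=\nabla^B_XY-\nabla^B_YX-\mu(X,Y)$. With $R^B(X,Y)=[\nabla^B_X,\nabla^B_Y]-\nabla^B_{\mu(X,Y)}$, the Bismut Ricci form is $\rho^B(X,Y)=\frac12\sum_k g(R^B(X,Y)e_k,J_0e_k)$ for a $g$-orthonormal basis $\{e_k\}$, and $(\rho^B)^{1,1}(X,Y)=\frac12(\rho^B(X,Y)+\rho^B(J_0X,J_0Y))$. Notation: $\rho^B(\omega)$ is the Bismut Ricci form for the bracket $\mu_0$ and the form $\omega$; $\rho^B_\mu$ is the one for the bracket $\mu$ and the form $\omega_0$. The endomorphisms $P(\omega)$ and $P_\mu$ are defined by $$\omega(P(\omega)X,Y)=(\rho^B)^{1,1}(\omega)(X,Y),\qquad \omega_0(P_\mu X,Y)=(\rho^B_\mu)^{1,1}(X,Y).$$ For $h\in\mathrm{GL}(n,\mathbb C)$: $(h^*\omega_0)(X,Y)=\omega_0(hX,hY)$ and $(h\cdot\mu_0)(X,Y)=h\,\mu_0(h^{-1}X,h^{-1}Y)$. For an endomorphism $\alpha$ of $\mathbb R^{2n}$ commuting with $J_0$, $$\delta_\mu(\alpha)=\mu(\alpha\cdot,\cdot)+\mu(\cdot,\alpha\cdot)-\alpha\,\mu(\cdot,\cdot).$$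 *)

(* Defs.v *)
From HB Require Import structures.
From mathcomp Require Import all_boot all_order all_algebra.
From mathcomp Require Import boolp classical_sets functions reals topology.
From mathcomp Require Import normedtype.

Set Implicit Arguments.
Unset Strict Implicit.
Unset Printing Implicit Defensive.

Import Order.TTheory GRing.Theory Num.Theory.
Import numFieldNormedType.Exports.
Local Open Scope classical_set_scope.
Local Open Scope ring_scope.

(* R^{2n} is the space of column vectors with coordinates
   (x_1, .., x_n, y_1, .., y_n); an endomorphism of R^{2n} is a square matrix
   acting by left multiplication.  Brackets, 2-forms and connections are plain
   functions of two vectors, constrained by predicates. *)
Notation vec R n := 'cV[R]_(n + n).

Section Calculus.
Context {R : realType} {V : normedModType R}.

(* f'(t) = v relative to the domain I: the library's two-sided derivative at an
   interior point of I, the one-sided derivative at an endpoint of I. *)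
Definition has_derivative_in (I : set R) (f : R -> V) (t : R) (v : V) : Prop :=
  (fun s => (s - t)^-1 *: (f s - f t)) @ within I t^' --> v.

End Calculus.

Section Hermitian.
Context {R : realType} {n : nat}.
Notation E := (vec R n).

Definition J0 : 'M[R]_(n + n) := block_mx 0 (- 1%:M) 1%:M 0.

Definition inner (X Y : E) : R := \sum_i X i 0 * Y i 0.

Definition omega0 (X Y : E) : R := inner X (J0 *m Y).

Definition GLC (h : 'M[R]_(n + n)) : Prop :=
  h \in unitmx /\ h *m J0 = J0 *m h.

Definition two_form (omega : E -> E -> R) : Prop :=
  bilinear_for *%R *%R omega /\ (forall X, omega X X = 0).

Definition inner_product (g : E -> E -> R) : Prop :=
  [/\ bilinear_for *%R *%R g,
      (forall X Y, g X Y = g Y X)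
    & (forall X, X != 0 -> 0 < g X X)].

Definition metric (omega : E -> E -> R) (X Y : E) : R := omega (J0 *m X) Y.

Definition compatible (omega : E -> E -> R) : Prop :=
  [/\ two_form omega,
      (forall X Y, omega (J0 *m X) (J0 *m Y) = omega X Y)
    & inner_product (metric omega)].

Definition bracket (mu : E -> E -> E) : Prop :=
  bilinear_for *:%R *:%R mu /\ (forall X, mu X X = 0).

Definition jacobi (mu : E -> E -> E) : Prop :=
  forall X Y Z, mu X (mu Y Z) + mu Y (mu Z X) + mu Z (mu X Y) = 0.

Definition J0_integrable (mu : E -> E -> E) : Prop :=
  forall X Y, mu (J0 *m X) (J0 *m Y) - J0 *m mu (J0 *m X) Y
              - J0 *m mu X (J0 *m Y) - mu X Y = 0.

Definition complex_lie_brackets : set (E -> E -> E) :=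
  [set mu | [/\ bracket mu, jacobi mu & J0_integrable mu]].

Definition torsion (mu D : E -> E -> E) (X Y : E) : E :=
  D X Y - D Y X - mu X Y.

Definition curvature (mu D : E -> E -> E) (X Y Z : E) : E :=
  D X (D Y Z) - D Y (D X Z) - D (mu X Y) Z.

Definition alternating3 (c : E -> E -> E -> R) : Prop :=
  [/\ (forall X Y, c X X Y = 0),
      (forall X Y, c X Y Y = 0)
    & (forall X Y, c X Y X = 0)].

Definition is_bismut (mu : E -> E -> E) (omega : E -> E -> R)
    (D : E -> E -> E) : Prop :=
  let g := metric omega in
  [/\ bilinear_for *:%R *:%R D,
      (forall X Y Z, g (D X Y) Z + g Y (D X Z) = 0),
      (forall X Y, D X (J0 *m Y) = J0 *m D X Y)
    & alternating3 (fun X Y Z => g X (torsion mu D Y Z))].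

(* The Bismut connection exists and is unique when mu is in
   complex_lie_brackets and omega is compatible; otherwise, if there is no such
   connection, the value is the dummy 0. *)
Definition bismut (mu : E -> E -> E) (omega : E -> E -> R) : E -> E -> E :=
  xget (fun _ _ => 0) [set D | is_bismut mu omega D].

Definition orthonormal_frame (g : E -> E -> R) (e : 'I_(n + n) -> E) : Prop :=
  forall i j, g (e i) (e j) = (i == j)%:R.

(* 2n orthonormal vectors of R^{2n} form a basis; the trace defining the Ricci
   form does not depend on which orthonormal basis is picked. *)
Definition some_frame (g : E -> E -> R) : 'I_(n + n) -> E :=
  xget (fun=> 0) [set e | orthonormal_frame g e].

Definition bismut_ricci (mu : E -> E -> E) (omega : E -> E -> R)
    (X Y : E) : R :=
  let g := metric omega in
  let e := some_frame g in
  2^-1 * \sum_k g (curvature mu (bismut mu omega) X Y (e k)) (J0 *m e k).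

Definition bismut_ricci11 (mu : E -> E -> E) (omega : E -> E -> R)
    (X Y : E) : R :=
  2^-1 * (bismut_ricci mu omega X Y
          + bismut_ricci mu omega (J0 *m X) (J0 *m Y)).

(* The endomorphism P with omega (P X) Y = (rho^B)^{1,1} X Y; it is unique
   because a compatible omega is nondegenerate.  P(omega) is
   ricci_endo mu0 omega, and P_mu is ricci_endo mu omega0. *)
Definition ricci_endo (mu : E -> E -> E) (omega : E -> E -> R) :
    'M[R]_(n + n) :=
  xget 0 [set P : 'M[R]_(n + n) |
    forall X Y, omega (P *m X) Y = bismut_ricci11 mu omega X Y].

Definition pullback (h : 'M[R]_(n + n)) (omega : E -> E -> R)
    (X Y : E) : R := omega (h *m X) (h *m Y).

Definition act (h : 'M[R]_(n + n)) (mu : E -> E -> E) (X Y : E) : E :=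
  h *m mu (invmx h *m X) (invmx h *m Y).

Definition delta (mu : E -> E -> E) (alpha : 'M[R]_(n + n)) (X Y : E) : E :=
  mu (alpha *m X) Y + mu X (alpha *m Y) - alpha *m mu X Y.

(* Curves of forms and of brackets live in finite-dimensional spaces, so they
   are differentiated by evaluating at each pair of vectors. *)
Definition form_flow (mu0 : E -> E -> E) (I : set R)
    (omega : R -> E -> E -> R) : Prop :=
  [/\ omega 0 = omega0,
      (forall t, I t -> compatible (omega t))
    & (forall t, I t -> forall X Y,
         has_derivative_in I (fun s => omega s X Y) t
           (- bismut_ricci11 mu0 (omega t) X Y))].

(* P_mu is only defined for mu in complex_lie_brackets, so a solution of the
   bracket flow is a curve in that set. *)
Definition bracket_flow (mu0 : E -> E -> E) (I : set R)
    (mu : R -> E -> E -> E) : Prop :=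
  [/\ mu 0 = mu0,
      (forall t, I t -> complex_lie_brackets (mu t))
    & (forall t, I t -> forall X Y,
         has_derivative_in I (fun s => mu s X Y) t
           (2^-1 *: delta (mu t) (ricci_endo (mu t) omega0) X Y))].

End Hermitian.

(* Main.v *)
(** Let [h] solve the linear equation [h' = - P_mu h / 2] with [h(0) = 1].  Its
    inverse [k] solves [k' = k P_mu / 2], so [h] is invertible; it commutes with
    [J0] because [P_mu] does; and [k mu(h X, h Y)] has derivative zero, which
    gives [mu = h . mu0].  Since [P_mu] is [omega0]-symmetric, the derivative of
    [h^* omega0] is [- rho^{1,1}_mu (h X, h Y)], which by naturality is
    [- rho^{1,1} (h^* omega0) (X, Y)] for the bracket [mu0].  So [h^* omega0] and
    [omega] solve the same form flow, and they agree by Gronwall's lemma.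

    Continuity of [P_mu] and the Lipschitz estimate come from the formula, with
    [W = mu(X, Y)] and any orthonormal basis [e_k],
      [2 rho^B(X, Y) = tr (J0 ad_W) + tr ad_(J0 W) + sum_k g(mu(e_k, J0 e_k), W)],
    which holds since [D_X] and [D_Y] commute with [J0], so that only
    [D_(mu(X, Y))] contributes to the trace of [J0 R^B(X, Y)].  *)

Require Import Defs.
From mathcomp Require Import all_boot all_order all_algebra.
From mathcomp Require Import ring lra.
From mathcomp Require Import boolp classical_sets functions reals topology.
From mathcomp Require Import normedtype derive sequences exp realfun.
From mathcomp Require Import measure lebesgue_measure lebesgue_integral ftc.
Set Implicit Arguments.
Unset Strict Implicit.
Unset Printing Implicit Defensive.
Import Order.TTheory GRing.Theory Num.Theory.
Import numFieldNormedType.Exports.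
Local Open Scope classical_set_scope.
Local Open Scope ring_scope.

(** * Derivatives relative to a set *)

(** Once [mu] is given, the equation for [h] is linear with known coefficients, so [h] exists on all
    of [K] and no short-time restriction appears; a vector field depending on the unknown pullback
    of [omega0] would not give this. The form flow is nonlinear, but what is used is its uniqueness,
    and only between two given curves: on a compact segment the difference of the two velocities is
    a combination of differences of entries of the forms, with continuous and hence bounded
    coefficients. No Lipschitz constant on a region of the space of forms is sought. The obstacle
    there is the orthonormal frame, which is chosen separately for each form and may jump in time;
    contractions are therefore rewritten with the inverse Gram matrix. The intervals may be open,
    closed, one-sided at 0 or a single point, so derivatives are relative to a set. The analysis is
    done on segments containing 0 and carried to an interval by uniqueness. *)

Definition continuous_in {R : realType} (D : set R) (f : R -> R) : Prop :=
  forall t, D t -> f s @[s --> within D (nbhs t)] --> f t.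

Section DerivativeIn.
Context {R : realType}.
Implicit Types (D : set R) (f g : R -> R) (t : R).

Lemma has_derivative_in_sub (V : normedModType R) D D' (f : R -> V) t v :
  D' `<=` D -> has_derivative_in D f t v -> has_derivative_in D' f t v.
Proof.
move=> sD df; apply: (cvg_trans _ df); apply: cvg_app => P.
rewrite !nbhs_filterE /within /=.
by apply: filterS => x DP /sD.
Qed.

Lemma has_derivative_in_ext (V : normedModType R) D (f g : R -> V) t v :
  D t -> (forall s, D s -> f s = g s) ->
  has_derivative_in D f t v -> has_derivative_in D g t v.
Proof.
move=> Dt fg df; apply: (cvg_trans _ df); apply: near_eq_cvg.
rewrite near_withinE; apply: nearW => s Ds.
by rewrite !fg.
Qed.

Lemma within_dnbhsE D t (P : set R) :
  within D t^' P <-> (\forall s \near within D (nbhs t), s != t -> P s).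
Proof.
split=> H.
  have {}H : nbhs t (fun s => s != t -> D s -> P s) by [].
  by apply: filterS H => s H Ds st; exact: H.
have {}H : nbhs t (fun s => D s -> s != t -> P s) by [].
by apply: filterS H => s H st Ds; exact: H.
Qed.

(** Off [t], [f s] is [f t] plus [s - t] times the difference quotient. The limit defining the
    derivative omits the point [t], which is put back at the end. *)
Lemma has_derivative_in_continuous D f t v :
  has_derivative_in D f t v -> f s @[s --> within D (nbhs t)] --> f t.
Proof.
move=> df.
have ft : f s @[s --> within D t^'] --> f t.
  have : f t + (s - t) * ((s - t)^-1 *: (f s - f t)) @[s --> within D t^']
      --> f t + (t - t) * v.
    apply: cvgD; first exact: cvg_cst.
    apply: cvgM; last exact: df.
    apply: cvgB; last exact: cvg_cst.
    by apply: cvg_within_filter; exact: (@nbhs_dnbhs R t).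
  rewrite subrr mul0r addr0; apply: cvg_trans; apply: near_eq_cvg.
  rewrite near_withinE; apply: filterS (nbhs_dnbhs_neq t) => s st _ /=.
  rewrite [_ *: _]/(_ * _) mulrA divff ?subr_eq0 //; ring.
move=> P Pf; have /within_dnbhsE := ft P Pf; apply: filterS => s H.
have [->|/H//] := eqVneq s t; exact: (nbhs_singleton Pf).
Qed.

Lemma has_derivative_in_cst D (c : R) t : has_derivative_in D (fun=> c) t 0.
Proof.
rewrite /has_derivative_in; under eq_cvg do rewrite subrr scaler0.
exact: cvg_cst.
Qed.

Lemma has_derivative_inD D f g t u v :
  has_derivative_in D f t u -> has_derivative_in D g t v ->
  has_derivative_in D (fun s => f s + g s) t (u + v).
Proof.
move=> df dg; rewrite /has_derivative_in.
under eq_cvg do rewrite opprD addrACA scalerDr.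
exact: cvgD.
Qed.

Lemma has_derivative_inM D f g t u v :
  has_derivative_in D f t u -> has_derivative_in D g t v ->
  has_derivative_in D (fun s => f s * g s) t (u * g t + f t * v).
Proof.
move=> df dg; rewrite /has_derivative_in.
under eq_cvg => s.
  rewrite (_ : _ *: _ = ((s - t)^-1 *: (f s - f t)) * g s
    + f t * ((s - t)^-1 *: (g s - g t))); last by rewrite /GRing.scale /=; ring.
over.
apply: cvgD; apply: cvgM => //; last exact: cvg_cst.
move=> P Pg; have /= := has_derivative_in_continuous dg Pg.
  move=> H; apply/within_dnbhsE.
  have {}H : within D (nbhs t) (fun s => P (g s)) by [].
  by apply: filterS H.
Qed.

Lemma has_derivative_inZ D (c : R) f t u :
  has_derivative_in D f t u -> has_derivative_in D (fun s => c * f s) t (c * u).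
Proof.
move=> df; have := has_derivative_inM (has_derivative_in_cst D c t) df.
by rewrite mul0r add0r.
Qed.

Lemma has_derivative_inN D f t u :
  has_derivative_in D f t u -> has_derivative_in D (fun s => - f s) t (- u).
Proof.
move=> /(@has_derivative_inZ _ (- 1)); rewrite mulN1r.
by under eq_fun do rewrite mulN1r.
Qed.

Lemma has_derivative_inB D f g t u v :
  has_derivative_in D f t u -> has_derivative_in D g t v ->
  has_derivative_in D (fun s => f s - g s) t (u - v).
Proof. by move=> df /has_derivative_inN; exact: has_derivative_inD. Qed.

Lemma has_derivative_in_sum D (T : finType) (f : T -> R -> R) t (v : T -> R) :
  (forall i, has_derivative_in D (f i) t (v i)) ->
  has_derivative_in D (fun s => \sum_i f i s) t (\sum_i v i).
Proof.
move=> df; elim: (index_enum T) => [|i r IH].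
  rewrite big_nil; under eq_fun do rewrite big_nil.
  exact: has_derivative_in_cst.
rewrite big_cons; under eq_fun do rewrite big_cons.
exact: has_derivative_inD.
Qed.

Lemma has_derivative_in_is_derive D f t v :
  nbhs t D -> has_derivative_in D f t v -> is_derive t 1 f v.
Proof.
move=> Dt df.
have H : (fun s => (s - t)^-1 *: (f s - f t)) @ t^' --> v.
  move=> P /df; rewrite /= => /within_dnbhsE H.
  apply: filterS2 Dt H => s Ds H st; exact: H.
have H0 : h^-1 *: ((f \o shift t) (h *: (1 : R)) - f t) @[h --> 0^'] --> v.
  move=> P /H; rewrite /= !nbhs_filterE /dnbhs /within /= => {}H.
  have : \forall s \near t, s != t -> P ((s - t)^-1 *: (f s - f t)) by exact: H.
  move/nbhs0P; apply: filterS => s /=.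
  rewrite scaler1 (addrC t) addrK -[in X in X -> _](subr0 s).
  by rewrite -[X in X != t](subrK t) addrK -subr_eq0 addrK subr0.
apply: DeriveDef; first by apply/cvg_ex; exists v.
exact: cvg_lim.
Qed.

End DerivativeIn.

(** * Continuity relative to a set *)

Section ContinuousIn.
Context {R : realType}.
Implicit Types (D : set R) (f g : R -> R).

Lemma continuous_inP D f : continuous_in D f <-> {within D, continuous f}.
Proof. by split => /subspace_continuousP. Qed.

Lemma continuous_in_sub D D' f :
  D' `<=` D -> continuous_in D f -> continuous_in D' f.
Proof.
move=> sD cf t Dt; apply: (cvg_trans _ (cf t (sD t Dt))); apply: cvg_app => P.
rewrite !nbhs_filterE /within /=.
by apply: filterS => x DP /sD.
Qed.

Lemma continuous_in_ext D f g :
  (forall s, D s -> f s = g s) -> continuous_in D f -> continuous_in D g.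
Proof.
move=> fg cf t Dt; rewrite -fg //; apply: (cvg_trans _ (cf t Dt)).
by apply: near_eq_cvg; rewrite near_withinE; apply: nearW => s /fg.
Qed.

Lemma continuous_in_cst D (c : R) : continuous_in D (fun=> c).
Proof. by move=> t Dt; exact: cvg_cst. Qed.

Lemma continuous_inD D f g :
  continuous_in D f -> continuous_in D g ->
  continuous_in D (fun s => f s + g s).
Proof. by move=> cf cg t Dt; apply: cvgD; [exact: cf|exact: cg]. Qed.

Lemma continuous_inN D f :
  continuous_in D f -> continuous_in D (fun s => - f s).
Proof. by move=> cf t Dt; apply: cvgN; exact: cf. Qed.

Lemma continuous_inM D f g :
  continuous_in D f -> continuous_in D g ->
  continuous_in D (fun s => f s * g s).
Proof. by move=> cf cg t Dt; apply: cvgM; [exact: cf|exact: cg]. Qed.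

Lemma continuous_in_sum D (T : finType) (f : T -> R -> R) :
  (forall i, continuous_in D (f i)) ->
  continuous_in D (fun s => \sum_i f i s).
Proof.
move=> cf; elim: (index_enum T) => [|i r IH].
  under eq_fun do rewrite big_nil.
  exact: continuous_in_cst.
under eq_fun do rewrite big_cons.
exact: continuous_inD.
Qed.

Lemma continuous_in_prod D (T : finType) (f : T -> R -> R) :
  (forall i, continuous_in D (f i)) ->
  continuous_in D (fun s => \prod_i f i s).
Proof.
move=> cf; elim: (index_enum T) => [|i r IH].
  under eq_fun do rewrite big_nil.
  exact: continuous_in_cst.
under eq_fun do rewrite big_cons.
exact: continuous_inM.
Qed.

Lemma continuous_inV D f :
  (forall t, D t -> f t != 0) -> continuous_in D f ->
  continuous_in D (fun s => (f s)^-1).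
Proof. by move=> f0 cf t Dt; apply: cvgV; [exact: f0|exact: cf]. Qed.

Lemma continuous_in_bounded (a b : R) f :
  a <= b -> continuous_in `[a, b] f ->
  exists2 M : R, 0 <= M & forall t, a <= t <= b -> `|f t| <= M.
Proof.
move=> ab /continuous_inP cf.
have [c _ Hc] := EVT_max ab cf; have [d _ Hd] := EVT_min ab cf.
exists (`|f c| + `|f d|) => [|t tab]; first by rewrite addr_ge0.
have {}tab : t \in `[a, b]%R by rewrite in_itv.
have := Hc t tab; have := Hd t tab; rewrite ler_norml.
have := ler_norm (f c); have := ler_norm (- f d); rewrite normrN.
have := normr_ge0 (f c); have := normr_ge0 (f d); lra.
Qed.

End ContinuousIn.

(** * Monotonicity, exponential bounds and geometric limits *)

Section MeanValue.
Context {R : realType}.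
Implicit Types (f : R -> R).

Lemma is_derive_has_derivative_in (D : set R) f (t v : R) :
  is_derive t 1 f v -> has_derivative_in D f t v.
Proof.
move=> [df <-]; rewrite /has_derivative_in; apply: cvg_within_filter => P.
have H : h^-1 *: ((f \o shift t) (h *: (1 : R)) - f t) @[h --> 0^'] --> 'D_1 f t.
  exact: df.
move=> /H; rewrite /= !nbhs_filterE /dnbhs /within /= => {}H.
have {}H : \forall s \near 0, s != 0 -> P (s^-1 *: (f (s *: (1 : R) + t) - f t)).
  exact: H.
suff : \forall s \near t, s != t -> P ((s - t)^-1 *: (f s - f t)) by [].
apply/nbhs0P; apply: filterS H => s /=.
rewrite scaler1 (addrC t) addrK => Hs; rewrite -[X in _ != X]add0r.
by rewrite (inj_eq (addIr t)).
Qed.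

(** The mean value theorem asks for two-sided derivatives only in the open segment, where the
    relative derivative is one, and for continuity up to the ends. *)
Lemma ge0_has_derivative_in_le (a b : R) f (v : R -> R) : a <= b ->
  (forall t, a <= t <= b -> has_derivative_in `[a, b] f t (v t)) ->
  (forall t, a <= t <= b -> 0 <= v t) -> f a <= f b.
Proof.
move=> ab df v0.
have [||c] := MVT_segment (f := f) (df := v) ab.
- move=> x xab; apply: (@has_derivative_in_is_derive _ `[a, b]).
    by apply: filterS (near_in_itvoo xab) => y; exact: subset_itv_oo_cc.
  by apply: df; move: xab; rewrite in_itv /= => /andP[/ltW -> /ltW ->].
- apply/continuous_inP => t /= /[!in_itv] /= tab.
  exact: has_derivative_in_continuous (df t tab).
rewrite in_itv /= => cab H; rewrite -subr_ge0 H mulr_ge0 ?subr_ge0 //.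
exact: v0.
Qed.

Lemma has_derivative_in_expR (D : set R) (L t : R) :
  has_derivative_in D (fun s => expR (L * s)) t (L * expR (L * t)).
Proof.
apply: is_derive_has_derivative_in.
have H : is_derive t 1 (fun s : R => L * s) L.
  have := is_deriveZ (f := id) L (is_derive_id t (1 : R)).
  by rewrite /GRing.scale /= mulr1.
by have := is_derive1_comp (is_derive_expR (L * t)) H; rewrite mulrC.
Qed.

(** To the right of 0, both [B / L * expR (L * s) + f s] and the same with [- f s] have nonnegative
    derivative, so they stay above their value [B / L] at 0. To the left the exponent changes sign.
    The sign is the parameter [e] in the proof. *)
Lemma expR_bound (a b L B : R) f (v : R -> R) : a <= 0 -> 0 <= b -> 0 < L ->
  f 0 = 0 ->
  (forall t, a <= t <= b -> has_derivative_in `[a, b] f t (v t)) ->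
  (forall t, a <= t <= b -> `|v t| <= B * expR (L * `|t|)) ->
  forall t, a <= t <= b -> `|f t| <= B / L * expR (L * `|t|).
Proof.
move=> a0 b0 L0 f0 df Hv t tab.
have B0 : 0 <= B.
  have := Hv 0; rewrite normr0 mulr0 expR0 mulr1 a0 b0 => /(_ isT).
  exact: le_trans.
have BL0 : 0 <= B / L by rewrite divr_ge0 // ltW.
have LBL x : B / L * (L * x) = B * x by rewrite mulrA divfK // gt_eqF.
have [t0|t0] := leP 0 t.
  have tsW s : 0 <= s <= t -> a <= s <= b.
    case/andP: tab => _ tb /andP[s0 st].
    by rewrite (le_trans a0 s0) (le_trans st tb).
  have ts : `[0, t] `<=` `[a, b] by move=> s; rewrite /= !in_itv; exact: tsW.
  have H (e : R) : `|e| = 1 -> B / L <= B / L * expR (L * t) + e * f t.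
    move=> e1.
    have := @ge0_has_derivative_in_le 0 t
      (fun s => B / L * expR (L * s) + e * f s)
      (fun s => B / L * (L * expR (L * s)) + e * v s) t0.
    rewrite /= f0 !mulr0 addr0 expR0 mulr1; apply.
    - move=> s st; apply: has_derivative_inD; apply: has_derivative_inZ.
        exact: has_derivative_in_expR.
      exact: has_derivative_in_sub ts (df _ (tsW _ st)).
    - move=> s st; rewrite LBL -lerBlDr sub0r.
      apply: le_trans (ler_norm _) _; rewrite normrN normrM e1 mul1r.
      by have := Hv s (tsW s st); rewrite [`|s|]ger0_norm //; case/andP: st.
  have := H 1 (normr1 _); have := H (- 1); rewrite normrN1 => /(_ erefl).
  rewrite [`|t|]ger0_norm // ler_norml mul1r mulN1r; lra.
have {}t0 := ltW t0.
have tsW s : t <= s <= 0 -> a <= s <= b.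
  case/andP: tab => ta _ /andP[s0 st].
  by rewrite (le_trans ta s0) (le_trans st b0).
have ts : `[t, 0] `<=` `[a, b] by move=> s; rewrite /= !in_itv; exact: tsW.
have H (e : R) : `|e| = 1 -> - (B / L) * expR (- L * t) + e * f t <= - (B / L).
  move=> e1.
  have := @ge0_has_derivative_in_le t 0
    (fun s => - (B / L) * expR (- L * s) + e * f s)
    (fun s => - (B / L) * (- L * expR (- L * s)) + e * v s) t0.
  rewrite /= f0 !mulr0 addr0 expR0 mulr1; apply.
  - move=> s st; apply: has_derivative_inD; apply: has_derivative_inZ.
      exact: has_derivative_in_expR.
    exact: has_derivative_in_sub ts (df _ (tsW _ st)).
  - move=> s st; rewrite mulNr mulNr mulrN opprK LBL -lerBlDr sub0r.
    apply: le_trans (ler_norm _) _; rewrite normrN normrM e1 mul1r.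
    have := Hv s (tsW s st); rewrite [`|s|]ler0_norm; last by case/andP: st.
    by rewrite mulrN mulNr.
have := H 1 (normr1 _); have := H (- 1); rewrite normrN1 => /(_ erefl).
rewrite [`|t|]ler0_norm // ler_norml mul1r !mulN1r !mulNr !mulrN.
by move=> *; apply/andP; split; lra.
Qed.

(** For [x > 0], a natural number [n] above [c / x] would give [c < n * x <= 2 ^ n * x], against the
    bound at [n]. *)
Lemma le0_geometric (x c : R) : (forall k, x <= c / 2 ^+ k) -> x <= 0.
Proof.
move=> H; rewrite leNgt; apply/negP => x0.
have c0 : 0 < c by have := H 0%N; rewrite expr0 divr1; exact: lt_le_trans.
have := archi_boundP (x := c / x); rewrite divr_ge0 ?ltW // => /(_ isT).
set n := Num.bound _ => Hn; have := H n; apply/negP; rewrite -ltNge.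
rewrite ltr_pdivrMr ?exprn_gt0 // -ltr_pdivrMl // mulrC (lt_le_trans Hn) //.
by rewrite -natrX ler_nat ltnW // ltn_expl.
Qed.

(** The radius [r k = 2 * c / 2 ^ k] is the tail of the geometric series from [k] on, so the
    intervals of radius [r k] around [x k] are nested. The limit is the supremum of their left
    ends. *)
Lemma limit_geometric (x : nat -> R) (c : R) :
  (forall k, `|x k.+1 - x k| <= c / 2 ^+ k) ->
  exists l, forall k, `|l - x k| <= 2 * c / 2 ^+ k.
Proof.
move=> H; pose r k := 2 * c / 2 ^+ k.
have rS k : r k.+1 + c / 2 ^+ k = r k.
  by rewrite /r exprS; field; rewrite ?expf_neq0 ?pnatr_eq0.
have c0 : 0 <= c by have := H 0%N; rewrite expr0 divr1; exact: le_trans.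
have r0 k : 0 <= r k by rewrite /r divr_ge0 ?mulr_ge0 // exprn_ge0.
have inc k m : x k - r k <= x (k + m)%N - r (k + m)%N.
  elim: m => [|m IH]; first by rewrite addn0.
  rewrite (le_trans IH) // addnS -[in leLHS](rS (k + m)%N).
  have := H (k + m)%N; rewrite ler_norml; lra.
have dec k m : x (k + m)%N + r (k + m)%N <= x k + r k.
  elim: m => [|m IH]; first by rewrite addn0.
  rewrite (le_trans _ IH) // addnS -[in leRHS](rS (k + m)%N).
  have := H (k + m)%N; rewrite ler_norml; lra.
have cross k m : x k - r k <= x m + r m.
  have [km|mk] := leqP k m.
    have := inc k (m - k)%N; rewrite subnKC // => /le_trans; apply.
    by have := r0 m; lra.
  have := dec m (k - m)%N; rewrite subnKC ?(ltnW mk) //.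
  by have := r0 k; lra.
pose S := [set x k - r k | k in [set: nat]].
have S0 : S !=set0 by exists (x 0 - r 0), 0.
exists (sup S) => k; rewrite ler_distl; apply/andP; split.
  apply: ub_le_sup; last by exists k.
  by exists (x 0 + r 0) => _ [m _ <-]; exact: cross.
by apply: ge_sup => // _ [m _ <-]; exact: cross.
Qed.

End MeanValue.

(** * Linear differential equations *)

Section Primitive.
Context {R : realType}.

Lemma primitive (a b : R) (f : R -> R) : a <= 0 -> 0 <= b ->
  continuous_in `[a, b] f ->
  exists2 F : R -> R, F 0 = 0 &
    forall t, a <= t <= b -> has_derivative_in `[a, b] F t (f t).
Proof.
move=> a0 b0 cf; have ab := le_trans a0 b0.
(* Clamping to the segment extends [f] to a function continuous on the whole line, so that its
   primitive has a two-sided derivative even at [a] and [b]. *)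
pose c (t : R) := Num.max a (Num.min t b).
have cab t : a <= c t <= b.
  by rewrite /c le_max lexx /= ge_max ab ge_min lexx orbT.
have cE t : a <= t <= b -> c t = t.
  by case/andP=> ta tb; rewrite /c (min_idPl tb) (max_idPr ta).
have cc : continuous c.
  move=> t; apply: (@continuous_max R R (fun=> a) (fun s => Num.min s b)).
    exact: cvg_cst.
  by apply: (@continuous_min R R id (fun=> b)); [exact: cvg_id|exact: cvg_cst].
pose g := f \o c.
have cg : continuous g.
  move=> t P Pg.
  have := cf (c t); rewrite /= in_itv /= cab => /(_ isT P Pg).
  rewrite /= /within /= => H.
  have {}H : \forall x \near c t, x \in `[a, b]%R -> P (f x) by [].
  have {}H : \forall s \near t, c s \in `[a, b]%R -> P (f (c s)) by exact: (cc t _ H).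
  by apply: filterS H => s; rewrite in_itv /= cab; exact.
pose mu := @lebesgue_measure R.
(* Starting the integral at [a - 1] leaves every [t] of the segment, [a] included, strictly inside
   the domain of integration [[a - 1, t + 1]]. *)
pose F x := (\int[mu]_(t in [set` `[a - 1, x]]) g t)%R.
exists (fun t => F t - F 0) => [|t tab]; first by rewrite subrr.
have [dF FE] : derivable F t 1 /\ derive1 F t = g t.
  apply: (@continuous_FTC1_closed _ _ (a - 1) t (t + 1)).
  - by rewrite ltrDl.
  - apply: continuous_compact_integrable; first exact: segment_compact.
    exact: continuous_subspaceT.
  - by case/andP: tab => ta _; lra.
  - exact: cg.
have -> : f t = f t - 0 by rewrite subr0.
apply: has_derivative_inB; last exact: has_derivative_in_cst.
apply: is_derive_has_derivative_in; apply: DeriveDef => //.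
by rewrite -derive1E FE /g /= cE.
Qed.

End Primitive.

Section LinearODE.
Context {R : realType} {T : finType} (a b : R).
Hypotheses (a0 : a <= 0) (b0 : 0 <= b).

(* Integrating a bound [B * expR (rate M * `|t|)] gains the factor
   [(rate M)^-1]; [rate M] is large enough for one step of the integral equation
   to halve the weighted norm, so Gronwall's lemma and Picard's iteration both
   reduce to geometric series on the whole segment. *)
Let rate (M : R) := 2 * (#|T|%:R * M + 1).

(** Gronwall's lemma takes [d] equal to [f]; the Picard iteration takes for [d] the previous
    difference of iterates. *)
Lemma halving (M C : R) (f d : T -> R -> R) (v : T -> R -> R) : 0 <= M ->
  (forall i, f i 0 = 0) ->
  (forall i t, a <= t <= b -> has_derivative_in `[a, b] (f i) t (v i t)) ->
  (forall i t, a <= t <= b -> `|v i t| <= M * \sum_j `|d j t|) ->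
  (forall t, a <= t <= b -> \sum_j `|d j t| <= C * expR (rate M * `|t|)) ->
  forall t, a <= t <= b -> \sum_j `|f j t| <= C / 2 * expR (rate M * `|t|).
Proof.
move=> M0 f0 df Hv Hd t tab.
have C0 : 0 <= C.
  have := Hd 0; rewrite a0 b0 normr0 mulr0 expR0 mulr1 => /(_ isT).
  by apply: le_trans; exact: sumr_ge0.
(* The summand 1 in [rate M] keeps it positive when [M] is 0 or [T] is empty; the factor 2 produces
   the halving. *)
have r0 : 0 < rate M by rewrite /rate mulr_gt0 // ltr_wpDl // mulr_ge0.
have H i : `|f i t| <= M * C / rate M * expR (rate M * `|t|).
  apply: (expR_bound a0 b0 r0 (f0 i) (df i)) => // s sab.
  apply: le_trans (Hv i s sab) _; rewrite -mulrA ler_wpM2l //; exact: Hd.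
apply: le_trans (ler_sum _ (fun i _ => H i)) _.
rewrite sumr_const -[leLHS]mulr_natl mulrA ler_wpM2r ?expR_ge0 //.
rewrite [leLHS](_ : _ = #|T|%:R * M * C / rate M); last by ring.
rewrite ler_pdivrMr // [leRHS](_ : _ = (#|T|%:R * M + 1) * C).
  by rewrite ler_wpM2r // lerDl.
by rewrite /rate; field.
Qed.

(** A crude bound [C] on the compact segment starts the induction; each application of [halving]
    with [d = f] divides it by 2, so the weighted norm lies below every [C / 2 ^ k]. Times on both
    sides of 0 are covered at once. *)
Lemma gronwall (M : R) (f v : T -> R -> R) : 0 <= M ->
  (forall i, f i 0 = 0) ->
  (forall i t, a <= t <= b -> has_derivative_in `[a, b] (f i) t (v i t)) ->
  (forall i t, a <= t <= b -> `|v i t| <= M * \sum_j `|f j t|) ->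
  forall i t, a <= t <= b -> f i t = 0.
Proof.
move=> M0 f0 df Hv i t tab.
have ab := le_trans a0 b0.
have cf j : continuous_in `[a, b] (f j).
  move=> s; rewrite /= in_itv /= => sab.
  exact: has_derivative_in_continuous (df j s sab).
have bf j := continuous_in_bounded ab (cf j).
pose C := \sum_j projT1 (cid2 (bf j)).
have HC s : a <= s <= b -> \sum_j `|f j s| <= C.
  by move=> sab; apply: ler_sum => j _; case: (cid2 (bf j)) => /= B _; exact.
have r0 : 0 <= rate M by rewrite /rate mulr_ge0 // addr_ge0 // mulr_ge0.
have H k s : a <= s <= b ->
    \sum_j `|f j s| <= C / 2 ^+ k * expR (rate M * `|s|).
  elim: k s => [|k IH] s sab.
    rewrite expr0 divr1; apply: le_trans (HC s sab) _.
    rewrite ler_peMr //; last by rewrite -expR0 ler_expR mulr_ge0.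
    by apply: le_trans (HC s sab); exact: sumr_ge0.
  have := halving M0 f0 df Hv IH sab.
  by rewrite exprSr invfM mulrA.
apply/eqP; rewrite -normr_le0; apply: (@le0_geometric _ _ (C * expR (rate M * `|t|))).
move=> k; rewrite mulrAC; apply: le_trans (H k t tab).
by rewrite (bigD1 i) //= lerDl; exact: sumr_ge0.
Qed.

(** Picard iteration: the differences of successive iterates are halved in the weighted norm, so the
    iterates converge uniformly on the whole segment, however large the coefficients. The limit is
    continuous and is a fixed point of [step], and being a value of [step] is what makes it
    differentiable. *)
Lemma linear_ode_exists (A : T -> T -> R -> R) (y0 : T -> R) :
  (forall i j, continuous_in `[a, b] (A i j)) ->
  exists2 y : T -> R -> R, (forall i, y i 0 = y0 i) &
    forall i t, a <= t <= b ->
      has_derivative_in `[a, b] (y i) t (\sum_j A i j t * y j t).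
Proof.
move=> cA; have ab := le_trans a0 b0.
(* Making the primitive a total operator [P] lets [step] be defined before any continuity is known;
   on a discontinuous function its value is arbitrary. *)
have prim (f : R -> R) : exists F : R -> R, continuous_in `[a, b] f -> F 0 = 0 /\
    forall t, a <= t <= b -> has_derivative_in `[a, b] F t (f t).
  have [cf|ncf] := pselect (continuous_in `[a, b] f); last by exists f.
  by have [F F0 dF] := primitive a0 b0 cf; exists F.
have [P HP] := boolp.choice prim.
have bA i j := continuous_in_bounded ab (cA i j).
pose M := \sum_i \sum_j projT1 (cid2 (bA i j)).
have M0 : 0 <= M.
  by apply: sumr_ge0 => i _; apply: sumr_ge0 => j _; case: (cid2 _).
have HA i j t : a <= t <= b -> `|A i j t| <= M.
  move=> tab; rewrite /M (bigD1 i) //= (bigD1 j) //= -addrA.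
  case: (cid2 (bA i j)) => /= B B0 /(_ t tab) AB; rewrite ler_wpDr //.
  rewrite addr_ge0 //; apply: sumr_ge0 => k _; first by case: (cid2 _).
  by apply: sumr_ge0 => l _; case: (cid2 _).
have HAd i (d : T -> R -> R) t : a <= t <= b ->
    `|\sum_j A i j t * d j t| <= M * \sum_j `|d j t|.
  move=> tab; apply: le_trans (ler_norm_sum _ _ _) _; rewrite mulr_sumr.
  by apply: ler_sum => j _; rewrite normrM ler_wpM2r // HA.
pose step (y : T -> R -> R) i t :=
  y0 i + P (fun s => \sum_j A i j s * y j s) t.
pose y k := iter k step (fun i _ => y0 i).
have cAy (z : T -> R -> R) i : (forall j, continuous_in `[a, b] (z j)) ->
    continuous_in `[a, b] (fun s => \sum_j A i j s * z j s).
  by move=> cz; apply: continuous_in_sum => j; apply: continuous_inM.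
have dstep (z : T -> R -> R) i : (forall j, continuous_in `[a, b] (z j)) ->
    step z i 0 = y0 i /\ forall t, a <= t <= b ->
    has_derivative_in `[a, b] (step z i) t (\sum_j A i j t * z j t).
  move=> cz; have [P0 dP] := HP _ (cAy z i cz).
  split=> [|t tab]; first by rewrite /step P0 addr0.
  rewrite -[X in has_derivative_in _ _ _ X]add0r.
  by apply: has_derivative_inD; [exact: has_derivative_in_cst|exact: dP].
have cstep (z : T -> R -> R) i : (forall j, continuous_in `[a, b] (z j)) ->
    continuous_in `[a, b] (step z i).
  move=> cz t; rewrite /= in_itv /= => tab; have [_ dz] := dstep z i cz.
  exact: has_derivative_in_continuous (dz t tab).
have cy k i : continuous_in `[a, b] (y k i).
  elim: k i => [|k IH] i; first exact: continuous_in_cst.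
  exact: cstep.
have ddiff (z w : T -> R -> R) i : (forall j, continuous_in `[a, b] (z j)) ->
    (forall j, continuous_in `[a, b] (w j)) ->
    step z i 0 - step w i 0 = 0 /\ forall t, a <= t <= b ->
    has_derivative_in `[a, b] (fun s => step z i s - step w i s) t
      (\sum_j A i j t * (z j t - w j t)).
  move=> cz cw; have [z0 dz] := dstep z i cz; have [w0 dw] := dstep w i cw.
  split=> [|t tab]; first by rewrite z0 w0 subrr.
  under eq_bigr do rewrite mulrBr; rewrite sumrB.
  by apply: has_derivative_inB; [exact: dz|exact: dw].
have [C C0 HC] : exists2 C : R, 0 <= C &
    forall t, a <= t <= b -> \sum_i `|y 1%N i t - y 0%N i t| <= C.
  have bd i : exists2 B : R, 0 <= B &
      forall t, a <= t <= b -> `|y 1%N i t - y 0%N i t| <= B.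
    apply: (continuous_in_bounded ab).
    by apply: continuous_inD => //; exact: continuous_inN.
  exists (\sum_i projT1 (cid2 (bd i))).
    by apply: sumr_ge0 => i _; case: (cid2 _).
  move=> t tab; apply: ler_sum => i _.
  by case: (cid2 _) => /= B _; exact.
pose E (t : R) := expR (rate M * `|t|).
have r0 : 0 <= rate M by rewrite /rate mulr_ge0 // addr_ge0 // mulr_ge0.
have E1 t : 1 <= E t by rewrite /E -expR0 ler_expR mulr_ge0.
have Hk k t : a <= t <= b ->
    \sum_i `|y k.+1 i t - y k i t| <= C / 2 ^+ k * E t.
  elim: k t => [|k IH] t tab.
    rewrite expr0 divr1; apply: le_trans (HC t tab) _.
    by rewrite ler_peMr.
  rewrite exprSr invfM mulrA.
  apply: (@halving M _ (fun i s => y k.+2 i s - y k.+1 i s)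
    (fun i s => y k.+1 i s - y k i s) (fun i s =>
    \sum_j A i j s * (y k.+1 j s - y k j s))) => //.
  - by move=> i; have [] := ddiff (y k.+1) (y k) i (cy _) (cy _).
  - by move=> i; have [] := ddiff (y k.+1) (y k) i (cy _) (cy _).
  - by move=> i s; exact: (HAd i (fun j s => y k.+1 j s - y k j s)).
have [z Hz] : exists z : T -> R -> R, forall i t, a <= t <= b ->
    forall k, `|z i t - y k i t| <= 2 * (C * E t) / 2 ^+ k.
  suff H i t : {l | a <= t <= b ->
      forall k, `|l - y k i t| <= 2 * (C * E t) / 2 ^+ k}.
    by exists (fun i t => projT1 (H i t)) => i t; case: (H i t).
  apply: cid; have [tab|ntab] := boolP (a <= t <= b); last by exists 0.
  have [|l Hl] := @limit_geometric _ (fun k => y k i t) (C * E t).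
    move=> k; rewrite mulrAC; apply: le_trans (Hk k t tab).
    by rewrite (bigD1 i) //= lerDl; exact: sumr_ge0.
  by exists l.
(* Since 0 lies in the segment, [|t|] is at most [b - a], so [Em] replaces the weight by a constant
   and makes the convergence uniform in [t]. *)
pose Em := expR (rate M * (b - a)).
have EEm t : a <= t <= b -> E t <= Em.
  move=> /andP[ta tb]; rewrite /E /Em ler_expR ler_wpM2l // ler_norml.
  by apply/andP; split; have := a0; have := b0; lra.
have Hzu i t k : a <= t <= b -> `|z i t - y k i t| <= 2 * (C * Em) / 2 ^+ k.
  move=> tab; apply: le_trans (Hz i t tab k) _.
  by rewrite ler_wpM2r ?invr_ge0 ?exprn_ge0 // !ler_wpM2l // EEm.
have cz i : continuous_in `[a, b] (z i).
  move=> t; rewrite /= in_itv /= => tab; apply/cvgrPdist_le => /= e e0.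
  have [k Hk3] : exists k, 2 * (C * Em) / 2 ^+ k <= e / 3.
    apply: contrapT => /forallNP H.
    have : e / 3 <= 0.
      apply: (@le0_geometric _ _ (2 * (C * Em))) => k.
      by have /negP := H k; rewrite -ltNge => /ltW.
    lra.
  have := cy k i t; rewrite /= in_itv /= => /(_ tab).
  move/cvgrPdist_le => /= /(_ (e / 3)); rewrite divr_gt0 // => /(_ isT).
  rewrite !near_withinE; apply: filterS => s H abs.
  have := abs; rewrite /= in_itv /= => sab; have := H abs.
  have := Hzu i t k tab; have := Hzu i s k sab.
  rewrite !ler_norml => /andP[? ?] /andP[? ?] /andP[? ?].
  by apply/andP; split; lra.
(* Both sides are close to the iterate [k.+1]: the left by the convergence estimate, the right
   because that iterate is [step (y k)] and [halving] controls [step z - step (y k)] by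
   [z - y k]. *)
have zE i t : a <= t <= b -> z i t = step z i t.
  move=> tab; apply/eqP; rewrite -subr_eq0 -normr_le0.
  pose c := 2 * (C * Em).
  apply: (@le0_geometric _ _ (c + #|T|%:R * c / 2 * Em)) => k.
  have := Hzu i t k.+1 tab; rewrite -/c.
  have : \sum_j `|step z j t - step (y k) j t| <=
      #|T|%:R * c / 2 ^+ k / 2 * expR (rate M * `|t|).
    apply: (@halving M _ (fun i s => step z i s - step (y k) i s)
      (fun i s => z i s - y k i s) (fun i s =>
      \sum_j A i j s * (z j s - y k j s))) => //.
    - by move=> j; have [] := ddiff z (y k) j cz (cy _).
    - by move=> j; have [] := ddiff z (y k) j cz (cy _).
    - by move=> j s; exact: (HAd j (fun j s => z j s - y k j s)).
    - move=> s sab; apply: (@le_trans _ _ (#|T|%:R * c / 2 ^+ k)).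
        rewrite -mulrA mulr_natl -sumr_const.
        by apply: ler_sum => j _; exact: Hzu.
      apply: ler_peMr; last exact: E1.
      by rewrite divr_ge0 ?exprn_ge0 // !mulr_ge0 // expR_ge0.
  move=> H1 H2; apply: le_trans (ler_distD (y k.+1 i t) _ _) _.
  rewrite mulrDl; apply: lerD.
    apply: le_trans H2 _; rewrite ler_wpM2l ?mulr_ge0 ?expR_ge0 //.
    by rewrite lef_pV2 ?posrE ?exprn_gt0 // ler_weXn2l // ler1n.
  rewrite distrC; apply: (@le_trans _ _ (\sum_j `|step z j t - step (y k) j t|)).
    by rewrite (bigD1 i) //= lerDl; exact: sumr_ge0.
  apply: le_trans H1 _.
  rewrite [leRHS](_ : _ = #|T|%:R * c / 2 ^+ k / 2 * Em); last by ring.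
  rewrite ler_wpM2l ?EEm // !divr_ge0 ?exprn_ge0 // !mulr_ge0 //; exact: expR_ge0.
exists z.
  move=> i; rewrite zE ?a0 ?b0 //.
  by have [] := dstep z i cz.
move=> i t tab; apply: (@has_derivative_in_ext _ _ _ (step z i)).
- by rewrite /= in_itv.
- by move=> s; rewrite /= in_itv /= => sab; rewrite zE.
- by have [_] := dstep z i cz; exact.
Qed.

End LinearODE.

(** * Matrix-valued curves and linear equations on an arbitrary interval *)

Section MatrixCurves.
Context {R : realType}.
Implicit Types D K : set R.

Lemma has_derivative_in_mxP m n D (M : R -> 'M[R]_(m, n)) t V :
  has_derivative_in D M t V <->
  forall i j, has_derivative_in D (fun s => M s i j) t (V i j).
Proof.
split=> [dM i j|dM].
  rewrite /has_derivative_in; under eq_cvg => s.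
    rewrite (_ : _ *: _ = ((s - t)^-1 *: (M s - M t)) i j); last by rewrite !mxE.
  over.
  exact: (cvg_comp _ _ dM (@coord_continuous R m n i j V)).
apply/cvg_ballP => e e0.
have H i j : \forall s \near within D t^',
    ball (V i j) e ((s - t)^-1 *: (M s i j - M t i j)).
  by have /cvg_ballP := dM i j; exact.
have {}H : \forall s \near within D t^', forall i j,
    ball (V i j) e ((s - t)^-1 *: (M s i j - M t i j)).
  by apply: filter_forall => i; apply: filter_forall => j; exact: H.
apply: filterS H => s H; split=> // i j.
by rewrite !mxE; exact: H.
Qed.

Lemma has_derivative_in_mulmx m n p D (M : R -> 'M[R]_(m, n))
    (N : R -> 'M[R]_(n, p)) t U V :
  has_derivative_in D M t U -> has_derivative_in D N t V ->
  has_derivative_in D (fun s => M s *m N s) t (U *m N t + M t *m V).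
Proof.
move=> /has_derivative_in_mxP dM /has_derivative_in_mxP dN.
apply/has_derivative_in_mxP => i j; rewrite !mxE -big_split /=.
under eq_fun do rewrite mxE.
by apply: has_derivative_in_sum => k; exact: has_derivative_inM.
Qed.

Lemma has_derivative_in_mx_cst m n D (M : 'M[R]_(m, n)) t :
  has_derivative_in D (fun=> M) t 0.
Proof.
apply/has_derivative_in_mxP => i j; rewrite mxE; exact: has_derivative_in_cst.
Qed.

Lemma has_derivative_in_mxD m n D (M N : R -> 'M[R]_(m, n)) t U V :
  has_derivative_in D M t U -> has_derivative_in D N t V ->
  has_derivative_in D (fun s => M s + N s) t (U + V).
Proof.
move=> /has_derivative_in_mxP dM /has_derivative_in_mxP dN.
apply/has_derivative_in_mxP => i j; rewrite !mxE.
by under eq_fun do rewrite mxE; exact: has_derivative_inD.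
Qed.

Lemma has_derivative_in_mxZ m n D (c : R) (M : R -> 'M[R]_(m, n)) t U :
  has_derivative_in D M t U ->
  has_derivative_in D (fun s => c *: M s) t (c *: U).
Proof.
move=> /has_derivative_in_mxP dM.
apply/has_derivative_in_mxP => i j; rewrite !mxE.
by under eq_fun do rewrite mxE; exact: has_derivative_inZ.
Qed.

Lemma has_derivative_in_mxB m n D (M N : R -> 'M[R]_(m, n)) t U V :
  has_derivative_in D M t U -> has_derivative_in D N t V ->
  has_derivative_in D (fun s => M s - N s) t (U - V).
Proof.
move=> dM /(@has_derivative_in_mxZ _ _ _ (- 1)); rewrite scaleN1r.
by under eq_fun do rewrite scaleN1r; exact: has_derivative_in_mxD.
Qed.

Lemma has_derivative_in_trmx m n D (M : R -> 'M[R]_(m, n)) t U :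
  has_derivative_in D M t U ->
  has_derivative_in D (fun s => (M s)^T) t U^T.
Proof.
move=> /has_derivative_in_mxP dM.
apply/has_derivative_in_mxP => i j; rewrite mxE.
by under eq_fun do rewrite mxE; exact: dM.
Qed.

(** Locality, used for gluing: a derivative found on a segment is a derivative on the interval as
    soon as the segment fills a relative neighbourhood of the point. *)
Lemma has_derivative_in_near (V : normedModType R) D D' (f : R -> V) t v :
  within D (nbhs t) D' ->
  has_derivative_in D' f t v -> has_derivative_in D f t v.
Proof.
move=> DD' df; apply: (cvg_trans _ df); apply: cvg_app => P.
rewrite !nbhs_filterE /within /=.
move: DD'; rewrite /within /= => DD' H.
have {}DD' : t^' (fun s => D s -> D' s) by exact: nbhs_dnbhs.
by apply: filterS2 DD' H => s sD H Ds; exact: H (sD Ds).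
Qed.

Definition segment0 (t : R) : set R := `[Num.min t 0, Num.max t 0].

Lemma segment0_sub K t : is_interval K -> K 0 -> K t ->
  [/\ Num.min t 0 <= 0, 0 <= Num.max t 0, Num.min t 0 <= t <= Num.max t 0
    & segment0 t `<=` K].
Proof.
move=> iK K0 Kt; split.
- by rewrite ge_min lexx orbT.
- by rewrite le_max lexx orbT.
- by rewrite ge_min le_max lexx.
move=> s; rewrite /segment0 /= in_itv /=; case: (leP t 0) => t0; exact: iK.
Qed.

(** On each side, a point of [K] strictly beyond [t] is taken if there is one; otherwise [t] is
    itself that end of [K] and serves. The minimum or maximum with 0 then brings 0 into the
    segment. *)
Lemma compact_nbhs K t : is_interval K -> K 0 -> K t ->
  exists a b : R, [/\ a <= 0 <= b, a <= t <= b, `[a, b] `<=` K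
    & within K (nbhs t) `[a, b]%classic].
Proof.
move=> iK K0 Kt.
have Kmin x y : K x -> K y -> K (Num.min x y) by case: (leP x y).
have Kmax x y : K x -> K y -> K (Num.max x y) by case: (leP x y).
have [b [Kb tb b0 Hb]] : exists b : R, [/\ K b, t <= b, 0 <= b
    & \forall s \near t, K s -> s <= b].
  have [[c [Kc tc]]|H] := pselect (exists c : R, K c /\ t < c).
    exists (Num.max c 0); split; first exact: Kmax.
    - by rewrite le_max ltW.
    - by rewrite le_max lexx orbT.
    - near=> s => Ks; rewrite le_max; apply/orP; left.
      by apply/ltW; near: s; exact: lt_nbhsl.
  exists (Num.max t 0); split; first exact: Kmax.
  - by rewrite le_max lexx.
  - by rewrite le_max lexx orbT.
  - near=> s => Ks; rewrite le_max leNgt; apply/orP; left.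
    by apply/negP => ts; apply: H; exists s.
have [a [Ka ta a0 Ha]] : exists a : R, [/\ K a, a <= t, a <= 0
    & \forall s \near t, K s -> a <= s].
  have [[c [Kc tc]]|H] := pselect (exists c : R, K c /\ c < t).
    exists (Num.min c 0); split; first exact: Kmin.
    - by rewrite ge_min ltW.
    - by rewrite ge_min lexx orbT.
    - near=> s => Ks; rewrite ge_min; apply/orP; left.
      by apply/ltW; near: s; exact: lt_nbhsr.
  exists (Num.min t 0); split; first exact: Kmin.
  - by rewrite ge_min lexx.
  - by rewrite ge_min lexx orbT.
  - near=> s => Ks; rewrite ge_min leNgt; apply/orP; left.
    by apply/negP => ts; apply: H; exists s.
exists a, b; split; rewrite ?a0 ?ta //.
  by move=> s; rewrite /= in_itv /=; exact: iK.
rewrite /within /=; apply: filterS2 Ha Hb => s Ha Hb Ks.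
by rewrite /= in_itv /= Ha ?Hb.
Unshelve. all: by end_near. Qed.

Lemma has_derivative_in0_cst K (f : R -> R) : is_interval K -> K 0 ->
  (forall t, K t -> has_derivative_in K f t 0) ->
  forall t, K t -> f t = f 0.
Proof.
move=> iK K0 df t Kt; have [a0 b0 tab sK] := segment0_sub iK K0 Kt.
apply/eqP; rewrite -subr_eq0; apply/eqP.
apply: (@gronwall _ unit _ _ a0 b0 0 (fun _ s => f s - f 0) (fun _ _ => 0)) => //.
- by rewrite subrr.
- move=> _ s sab; rewrite -[X in has_derivative_in _ _ _ X](subr0 0).
  apply: has_derivative_inB; last exact: has_derivative_in_cst.
  apply: (has_derivative_in_sub sK); apply: df; apply: sK.
  by rewrite /segment0 /= in_itv.
- by move=> _ s _; rewrite normr0 mul0r.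
Qed.

Lemma mx_derivative0_cst m n K (M : R -> 'M[R]_(m, n)) :
  is_interval K -> K 0 ->
  (forall t, K t -> has_derivative_in K M t 0) ->
  forall t, K t -> M t = M 0.
Proof.
move=> iK K0 dM t Kt; apply/matrixP => i j.
apply: (has_derivative_in0_cst (f := fun s => M s i j) iK K0 _ Kt) => s Ks.
by have /has_derivative_in_mxP/(_ i j) := dM s Ks; rewrite mxE.
Qed.

(** Gronwall's lemma with the matrix positions as index set: one entry of [A Y] involves one column
    of [Y], whose norm is part of the full sum. *)
Lemma mx_linear_ode_unique m n K (A : R -> 'M[R]_m) (Y : R -> 'M[R]_(m, n)) :
  is_interval K -> K 0 ->
  (forall i j, continuous_in K (fun s => A s i j)) -> Y 0 = 0 ->
  (forall t, K t -> has_derivative_in K Y t (A t *m Y t)) ->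
  forall t, K t -> Y t = 0.
Proof.
move=> iK K0 cA Y0 dY t Kt; have [a0 b0 tab sK] := segment0_sub iK K0 Kt.
have bA i j := continuous_in_bounded (le_trans a0 b0)
  (continuous_in_sub sK (cA i j)).
pose M := \sum_i \sum_j projT1 (cid2 (bA i j)).
have M0 : 0 <= M.
  by apply: sumr_ge0 => i _; apply: sumr_ge0 => j _; case: (cid2 _).
have HA i j s : Num.min t 0 <= s <= Num.max t 0 -> `|A s i j| <= M.
  move=> tab'; rewrite /M (bigD1 i) //= (bigD1 j) //= -addrA.
  case: (cid2 (bA i j)) => /= B B0 /(_ s tab') AB; rewrite ler_wpDr //.
  rewrite addr_ge0 //; apply: sumr_ge0 => k _; first by case: (cid2 _).
  by apply: sumr_ge0 => l _; case: (cid2 _).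
apply/matrixP => i j; rewrite mxE.
apply: (@gronwall _ ('I_m * 'I_n)%type _ _ a0 b0 M (fun p s => Y s p.1 p.2)
  (fun p s => (A s *m Y s) p.1 p.2) M0 _ _ _ (i, j)) => //.
- by move=> p; rewrite Y0 mxE.
- move=> p s sab; have Ks : K s by apply: sK; rewrite /segment0 /= in_itv.
  apply: (has_derivative_in_sub sK).
  by have /has_derivative_in_mxP := dY s Ks.
move=> [k l] s sab; rewrite !mxE /=; apply: le_trans (ler_norm_sum _ _ _) _.
rewrite -(pair_bigA _ (fun x y => `|Y s x y|)) /= mulr_sumr.
apply: ler_sum => x _; rewrite normrM; apply: ler_pM => //; first exact: HA.
by rewrite (bigD1 l) //= lerDl; exact: sumr_ge0.
Qed.

(** For each [t] a solution [Z t] is chosen on the segment from 0 to [t], and the result is the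
    diagonal [Z t t]. By uniqueness it agrees with the solution on any segment of [K] around 0; one
    that is also a neighbourhood of [t] in [K] yields the derivative there. *)
Lemma mx_linear_ode_exists m n K (A : R -> 'M[R]_m) (Y0 : 'M[R]_(m, n)) :
  is_interval K -> K 0 ->
  (forall i j, continuous_in K (fun s => A s i j)) ->
  exists2 Y : R -> 'M[R]_(m, n), Y 0 = Y0 &
    forall t, K t -> has_derivative_in K Y t (A t *m Y t).
Proof.
move=> iK K0 cA.
have ex (a b : R) : a <= 0 -> 0 <= b -> `[a, b] `<=` K ->
    exists2 Y : R -> 'M[R]_(m, n), Y 0 = Y0 &
    forall t, a <= t <= b -> has_derivative_in `[a, b] Y t (A t *m Y t).
  move=> a0 b0 sK.
  have exj (j : 'I_n) : exists y : 'I_m -> R -> R, (forall i, y i 0 = Y0 i j) /\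
      forall i t, a <= t <= b ->
        has_derivative_in `[a, b] (y i) t (\sum_k A t i k * y k t).
    have [y y0 dy] := linear_ode_exists a0 b0 (fun i => Y0 i j)
      (fun i k => continuous_in_sub sK (cA i k)).
    by exists y.
  have [y Hy] := boolp.choice exj.
  exists (fun t => \matrix_(i, j) y j i t).
    by apply/matrixP => i j; rewrite mxE; have [] := Hy j.
  move=> t tab; apply/has_derivative_in_mxP => i j.
  apply: (has_derivative_in_ext (f := y j i)) => [|s _|].
  - by rewrite /= in_itv.
  - by rewrite mxE.
  - rewrite mxE; under eq_bigr do rewrite mxE.
    by have [_] := Hy j; exact.
have ext t : exists Y : R -> 'M[R]_(m, n), K t -> Y 0 = Y0 /\
    forall s, segment0 t s -> has_derivative_in (segment0 t) Y s (A s *m Y s).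
  have [Kt|] := pselect (K t); last by exists (fun=> 0).
  have [a0 b0 tab sK] := segment0_sub iK K0 Kt.
  have [Y Y0E dY] := ex _ _ a0 b0 sK; exists Y => _; split=> [//|s ts].
  by apply: dY; move: ts; rewrite /segment0 /= in_itv.
have [Z HZ] := boolp.choice ext.
have uniq (a b : R) (Y : R -> 'M[R]_(m, n)) : a <= 0 -> 0 <= b -> `[a, b] `<=` K ->
    Y 0 = Y0 ->
    (forall t, a <= t <= b -> has_derivative_in `[a, b] Y t (A t *m Y t)) ->
    forall t, a <= t <= b -> Z t t = Y t.
  move=> a0 b0 sK Y0E dY t tab.
  have Kt : K t by apply: sK; rewrite /= in_itv.
  have [ta0 tb0 ttab tsK] := segment0_sub iK K0 Kt.
  have [ZY0 dZ] := HZ t Kt.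
  apply/eqP; rewrite -subr_eq0; apply/eqP.
  have is0 : is_interval (segment0 t) by exact: interval_is_interval.
  apply: (@mx_linear_ode_unique _ _ (segment0 t) A (fun s => Z t s - Y s)) => //.
  - by rewrite /segment0 /= in_itv /= ta0.
  - by move=> i j; exact: (continuous_in_sub tsK).
  - by rewrite ZY0 Y0E subrr.
  - move=> s ts; rewrite mulmxBr; apply: has_derivative_in_mxB; first exact: dZ.
    have sub : segment0 t `<=` `[a, b].
      move=> u; rewrite /segment0 /= !in_itv /= => /andP[u1 u2].
      case/andP: tab => ta tb; apply/andP; split.
        by apply: le_trans u1; rewrite le_min ta.
      by apply: le_trans u2 _; rewrite ge_max tb.
    apply: (has_derivative_in_sub sub); apply: dY.
    by have := sub s ts; rewrite /= in_itv.
exists (fun t => Z t t); first by have [] := HZ 0 K0.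
move=> t Kt; have [a [b [/andP[a0 b0] tab sK nK]]] := compact_nbhs iK K0 Kt.
have [Y Y0E dY] := ex _ _ a0 b0 sK.
apply: (has_derivative_in_near nK).
rewrite (uniq a b Y) //; apply: (has_derivative_in_ext (f := Y)).
- by rewrite /= in_itv.
- by move=> s; rewrite /= in_itv /= => sab; rewrite (uniq a b Y).
- exact: dY.
Qed.

End MatrixCurves.

(** * Bilinear maps and orthonormal frames *)

Section Bilinear.
Context {R : realType} {N : nat}.
Notation E := 'cV[R]_N.

Definition unit_vec (i : 'I_N) : E := delta_mx i 0.

Lemma col_sum_unit (X : E) : X = \sum_i X i 0 *: unit_vec i.
Proof.
rewrite {1}[X]matrix_sum_delta; apply: eq_bigr => i _.
by rewrite big_ord1.
Qed.

(** Turns an identity between linear maps, known on vectors, into an identity between matrix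
    entries. *)
Lemma unit_vec_sandwich (A : 'M[R]_N) i j :
  ((unit_vec i)^T *m A *m unit_vec j) 0 0 = A i j.
Proof. by rewrite /unit_vec trmx_delta -rowE -colE !mxE. Qed.

Definition mx_of (f : E -> E) : 'M[R]_N := \matrix_(i, j) f (unit_vec j) i 0.

Section Maps.
Variables (V : lmodType R) (f : E -> E -> V).
Hypothesis bf : bilinear_for *:%R *:%R f.

Lemma bilDl X X' Y : f (X + X') Y = f X Y + f X' Y.
Proof. by have := bf.1 Y 1 X X'; rewrite /= !scale1r. Qed.
Lemma bilDr X Y Y' : f X (Y + Y') = f X Y + f X Y'.
Proof. by have := bf.2 X 1 Y Y'; rewrite /= !scale1r. Qed.
Lemma bil0l Y : f 0 Y = 0.
Proof. by have /eqP := bilDl 0 0 Y; rewrite addr0 addrC -subr_eq subrr => /eqP. Qed.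
Lemma bil0r X : f X 0 = 0.
Proof. by have /eqP := bilDr X 0 0; rewrite addr0 addrC -subr_eq subrr => /eqP. Qed.
Lemma bilZl a X Y : f (a *: X) Y = a *: f X Y.
Proof. by have := bf.1 Y a X 0; rewrite /= !addr0 bil0l addr0. Qed.
Lemma bilZr a X Y : f X (a *: Y) = a *: f X Y.
Proof. by have := bf.2 X a Y 0; rewrite /= !addr0 bil0r addr0. Qed.
Lemma bilNl X Y : f (- X) Y = - f X Y.
Proof. by rewrite -(scaleN1r X) bilZl scaleN1r. Qed.
Lemma bilNr X Y : f X (- Y) = - f X Y.
Proof. by rewrite -(scaleN1r Y) bilZr scaleN1r. Qed.
Lemma bil_suml (I : finType) (F : I -> E) Y :
  f (\sum_i F i) Y = \sum_i f (F i) Y.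
Proof. by apply: (big_morph (f^~ Y)) => [X X'|]; [exact: bilDl|exact: bil0l]. Qed.
Lemma bil_sumr (I : finType) (F : I -> E) X :
  f X (\sum_i F i) = \sum_i f X (F i).
Proof. by apply: (big_morph (f X)) => [Y Y'|]; [exact: bilDr|exact: bil0r]. Qed.

Lemma bil_expand X Y :
  f X Y = \sum_i \sum_j (X i 0 * Y j 0) *: f (unit_vec i) (unit_vec j).
Proof.
rewrite {1}[X]col_sum_unit bil_suml; apply: eq_bigr => i _.
rewrite {1}[Y]col_sum_unit bil_sumr; apply: eq_bigr => j _.
by rewrite bilZl bilZr scalerA.
Qed.
End Maps.

Lemma bil_mx_of (f : E -> E -> E) (bf : bilinear_for *:%R *:%R f) X Y :
  f X Y = mx_of (f X) *m Y.
Proof.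
rewrite {1}[Y]col_sum_unit (bil_sumr bf); apply/matrixP => i j.
rewrite (ord1 j) !mxE summxE; apply: eq_bigr => k _.
by rewrite (bilZr bf) !mxE mulrC.
Qed.

Section Forms.
Variable g : E -> E -> R.
Hypothesis bg : bilinear_for *%R *%R g.
(** Scalars are read as the module [R^o], so that the lemmas on vector-valued bilinear maps apply to
    forms. *)
Let bg' : @bilinear_for R E E R^o *:%R *:%R g := bg.

Lemma biformDl X X' Y : g (X + X') Y = g X Y + g X' Y.
Proof. exact: (bilDl bg'). Qed.
Lemma biformDr X Y Y' : g X (Y + Y') = g X Y + g X Y'.
Proof. exact: (bilDr bg'). Qed.
Lemma biformZl a X Y : g (a *: X) Y = a * g X Y.
Proof. exact: (bilZl bg'). Qed.
Lemma biformZr a X Y : g X (a *: Y) = a * g X Y.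
Proof. exact: (bilZr bg'). Qed.
Lemma biformNl X Y : g (- X) Y = - g X Y.
Proof. exact: (bilNl bg'). Qed.
Lemma biformNr X Y : g X (- Y) = - g X Y.
Proof. exact: (bilNr bg'). Qed.
Lemma biformBl X X' Y : g (X - X') Y = g X Y - g X' Y.
Proof. by rewrite biformDl biformNl. Qed.
Lemma biformBr X Y Y' : g X (Y - Y') = g X Y - g X Y'.
Proof. by rewrite biformDr biformNr. Qed.
Lemma biform0l Y : g 0 Y = 0. Proof. exact: (bil0l bg'). Qed.
Lemma biform_suml (I : finType) (F : I -> E) Y :
  g (\sum_i F i) Y = \sum_i g (F i) Y.
Proof. exact: (bil_suml bg'). Qed.
Lemma biform_sumr (I : finType) (F : I -> E) X :
  g X (\sum_i F i) = \sum_i g X (F i).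
Proof. exact: (bil_sumr bg'). Qed.
Lemma biform_expand X Y :
  g X Y = \sum_i \sum_j X i 0 * Y j 0 * g (unit_vec i) (unit_vec j).
Proof. exact: (bil_expand bg'). Qed.

Definition gram : 'M[R]_N := \matrix_(i, j) g (unit_vec i) (unit_vec j).

Lemma biform_gram X Y : g X Y = (X^T *m gram *m Y) 0 0.
Proof.
rewrite biform_expand exchange_big !mxE; apply: eq_bigr => j _.
rewrite mxE mulr_suml; apply: eq_bigr => i _; rewrite !mxE; ring.
Qed.
End Forms.

Section Frame.
Variable g : E -> E -> R.
Hypothesis bg : bilinear_for *%R *%R g.
Hypothesis sg : forall X Y, g X Y = g Y X.
Hypothesis pg : forall X, X != 0 -> 0 < g X X.

(** Gram-Schmidt by rank: the rows of [M] are [k] orthonormal vectors. As [k < N], the left kernel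
    of [gram g *m M^T] is nonzero and supplies a vector orthogonal to all of them, which is then
    normalised by [c]. *)
Lemma orthonormal_exists : exists e : 'I_N -> E,
  forall i j, g (e i) (e j) = (i == j)%:R.
Proof.
suff H k : (k <= N)%N ->
    exists M : 'M[R]_(k, N), M *m gram g *m M^T = 1%:M.
  have [M HM] := H N (leqnn N); exists (fun i => (row i M)^T) => i j.
  have <- : (M *m gram g *m M^T) i j = (i == j)%:R by rewrite HM mxE.
  rewrite biform_gram // trmxK -row_mul [LHS]mxE [RHS]mxE.
  by apply: eq_bigr => l _; rewrite !mxE.
elim: k => [|k IH] kN.
  by exists 0; apply/matrixP => -[].
have [M HM] := IH (ltnW kN).
have : kermx (gram g *m M^T) != 0.
  by rewrite -mxrank_eq0 mxrank_ker subn_eq0 -ltnNge (leq_ltn_trans (rank_leq_col _)).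
case/rowV0Pn => u /sub_kermxP uM u0.
have gu : (u *m gram g *m u^T) 0 0 = g u^T u^T by rewrite biform_gram // trmxK.
have gu0 : 0 < g u^T u^T.
  by apply: pg; apply: contraNneq u0 => uT; rewrite -(trmxK u) uT trmx0.
pose c := (Num.sqrt (g u^T u^T))^-1.
have cc : c * c * g u^T u^T = 1.
  rewrite /c -invfM -expr2 sqr_sqrtr ?ltW // mulVf // gt_eqF //.
have gT : (gram g)^T = gram g by apply/matrixP => i j; rewrite !mxE sg.
rewrite -addn1; exists (col_mx M (c *: u)).
rewrite mul_col_mx tr_col_mx mul_col_row HM scalar_mx_block.
have uM' : u *m gram g *m M^T = 0 by rewrite -mulmxA.
have Mu' : M *m gram g *m u^T = 0.
  by apply: trmx_inj; rewrite trmx_mul trmxK trmx_mul gT mulmxA uM' trmx0.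
rewrite linearZ /= -!scalemxAr Mu' scaler0 -!scalemxAl uM' scaler0.
congr block_mx; apply/matrixP => i j; rewrite !ord1 scalerA mxE gu cc.
by rewrite mxE.
Qed.

Variable e : 'I_N -> E.
Hypothesis oe : forall i j, g (e i) (e j) = (i == j)%:R.

Let F : 'M[R]_N := \matrix_(i, k) e k i 0.

Let colF k : F *m unit_vec k = e k.
Proof.
by rewrite /unit_vec -colE; apply/matrixP => i j; rewrite (ord1 j) !mxE.
Qed.

Let FGF : F^T *m gram g *m F = 1%:M.
Proof.
apply/matrixP => i j; rewrite [RHS]mxE -oe biform_gram // -!colF.
by rewrite -[LHS]unit_vec_sandwich trmx_mul !mulmxA.
Qed.

(** Orthonormality reads [F^T G F = 1], with the frame vectors as columns of [F]. For square
    matrices a left inverse is a right inverse, which gives this completeness relation: an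
    orthonormal frame is a basis. *)
Lemma frame_mul : F *m F^T *m gram g = 1%:M.
Proof. by rewrite -mulmxA; apply: mulmx1C; exact: FGF. Qed.

Lemma gram_unit : gram g \in unitmx.
Proof. by have [] := mulmx1_unit frame_mul. Qed.

Lemma frame_invmx : F *m F^T = invmx (gram g).
Proof. by rewrite -[LHS](mulmxK gram_unit) frame_mul mul1mx. Qed.

Lemma frame_expand X : X = \sum_k g (e k) X *: e k.
Proof.
rewrite -[LHS](mul1mx X) -frame_mul -!mulmxA.
rewrite [in LHS](col_sum_unit (F^T *m _)) mulmx_sumr.
apply: eq_bigr => k _; rewrite -scalemxAr colF biform_gram //; congr (_ *: _).
by rewrite -mulmxA !mxE; apply: eq_bigr => i _; rewrite !mxE.
Qed.

Lemma frame_trace (A : 'M[R]_N) : \sum_k g (A *m e k) (e k) = \tr A.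
Proof.
rewrite -[in RHS](mulmx1 A) -frame_mul mulmxA mxtrace_mulC !mulmxA mxtrace_mulC.
rewrite /mxtrace; apply: eq_bigr => k _.
by rewrite sg biform_gram // -!colF -[RHS]unit_vec_sandwich trmx_mul !mulmxA.
Qed.

(** The right-hand side sees the metric through its inverse Gram matrix alone. It shows that the
    contraction is independent of the frame, and how it varies with the metric. *)
Lemma frame_contract (V : lmodType R) (f : E -> E -> V) :
  bilinear_for *:%R *:%R f ->
  \sum_k f (e k) (e k) =
    \sum_i \sum_j invmx (gram g) i j *: f (unit_vec i) (unit_vec j).
Proof.
move=> bf; rewrite -frame_invmx.
under eq_bigr do rewrite (bil_expand bf).
rewrite exchange_big; apply: eq_bigr => i _.
rewrite exchange_big; apply: eq_bigr => j _.
rewrite -scaler_suml !mxE; congr (_ *: _).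
by apply: eq_bigr => k _; rewrite !mxE.
Qed.

End Frame.
End Bilinear.

(** * The Bismut connection and its Ricci form *)

Section Bismut.
Context {R : realType} {n : nat}.
Notation E := (vec R n).
Notation J := (@J0 R n).

Lemma J0_sqr : J *m J = - 1%:M.
Proof.
rewrite /J0 mulmx_block !mul0mx !mulmx0 !mulNmx !mulmxN !mul1mx !add0r !addr0.
by rewrite [in RHS]scalar_mx_block opp_block_mx oppr0.
Qed.

Lemma J0K (X : E) : J *m (J *m X) = - X.
Proof. by rewrite mulmxA J0_sqr mulNmx mul1mx. Qed.

Section Metric.
Variable omega : E -> E -> R.
Hypothesis co : compatible omega.
Notation g := (metric omega).

Lemma metric_bilinear : bilinear_for *%R *%R g.
Proof. by case: co => _ _ []. Qed.
Lemma metricC X Y : g X Y = g Y X.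
Proof. by case: co => _ _ []. Qed.
Lemma metric_gt0 X : X != 0 -> 0 < g X X.
Proof. by case: co => _ _ [_ _]; exact. Qed.
Lemma metric_JJ X Y : g (J *m X) (J *m Y) = g X Y.
Proof. by case: co => _ oJ _; rewrite /metric oJ. Qed.
Lemma metric_Jl X Y : g (J *m X) Y = - g X (J *m Y).
Proof.
by rewrite -metric_JJ J0K (biformNl metric_bilinear).
Qed.
Lemma omega_metric X Y : omega X Y = g X (J *m Y).
Proof. by case: co => _ oJ _; rewrite /metric oJ. Qed.

Lemma some_frameP : orthonormal_frame g (some_frame g).
Proof.
have [e oe] := orthonormal_exists metric_bilinear metricC metric_gt0.
exact: (@xgetI _ _ [set e | orthonormal_frame g e] e).
Qed.

Variable mu : E -> E -> E.
Hypothesis bmu : bracket mu.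
Hypothesis Jmu : J0_integrable mu.

Lemma bracket_skew X Y : mu X Y = - mu Y X.
Proof.
case: bmu => bm m0; apply/eqP; rewrite -addr_eq0; apply/eqP.
have := m0 (X + Y); rewrite (bilDl bm) !(bilDr bm) !m0 add0r addr0.
by [].
Qed.

Let m X Y Z := g (mu X Y) Z.

(* The Koszul formula of a metric connection with torsion
   [c = - d omega (J, J, J)], that is [c X Y Z = - (m (J X) (J Y) Z + cyclic)];
   its value is [2 * g (D X Y) Z]. *)
Let phi X Y Z := m X Y Z - m Y Z X + m Z X Y
  - m (J *m X) (J *m Y) Z - m (J *m Y) (J *m Z) X - m (J *m Z) (J *m X) Y.

Let m_skew X Y Z : m X Y Z = - m Y X Z.
Proof. by rewrite /m bracket_skew (biformNl metric_bilinear). Qed.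

Let m_int X Y Z : m (J *m X) (J *m Y) Z + m (J *m X) Y (J *m Z)
  + m X (J *m Y) (J *m Z) - m X Y Z = 0.
Proof.
have bg := metric_bilinear.
have := congr1 (g^~ Z) (Jmu X Y).
rewrite !(biformBl bg) (biform0l bg) !metric_Jl /m; lra.
Qed.

Let mNl X Y Z : m (- X) Y Z = - m X Y Z.
Proof. by rewrite /m (bilNl bmu.1) (biformNl metric_bilinear). Qed.
Let mNr X Y Z : m X (- Y) Z = - m X Y Z.
Proof. by rewrite /m (bilNr bmu.1) (biformNl metric_bilinear). Qed.
Let mNN X Y Z : m X Y (- Z) = - m X Y Z.
Proof. by rewrite /m (biformNr metric_bilinear). Qed.

Let phi_skew X Y Z : phi X Y Z = - phi X Z Y.
Proof.
rewrite /phi (m_skew X Z) (m_skew Z Y) (m_skew Y X) (m_skew (J *m X) (J *m Z)).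
rewrite (m_skew (J *m Z) (J *m Y)) (m_skew (J *m Y) (J *m X)); ring.
Qed.

(** Integrability enters here: with everything moved to the left, the identity is minus the sum of
    [m_int X Y (J Z)] and [m_int Z X (J Y)]. Through the metric it becomes the commutation of the
    connection with [J]. *)
Let phi_J X Y Z : phi X (J *m Y) Z = - phi X Y (J *m Z).
Proof.
rewrite /phi !J0K !mNr !mNl.
have := m_int X Y (J *m Z); have := m_int Z X (J *m Y).
rewrite !J0K !mNN; lra.
Qed.

Let philin1 a X X' Y Z : phi (a *: X + X') Y Z = a * phi X Y Z + phi X' Y Z.
Proof.
have bg := metric_bilinear; have bm := bmu.1.
rewrite /phi /m !mulmxDr -!scalemxAr.
rewrite !(bilDl bm, bilDr bm, bilZl bm, bilZr bm, biformDl bg, biformDr bg,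
  biformZl bg, biformZr bg); ring.
Qed.

Let philin2 a X Y Y' Z : phi X (a *: Y + Y') Z = a * phi X Y Z + phi X Y' Z.
Proof.
have bg := metric_bilinear; have bm := bmu.1.
rewrite /phi /m !mulmxDr -!scalemxAr.
rewrite !(bilDl bm, bilDr bm, bilZl bm, bilZr bm, biformDl bg, biformDr bg,
  biformZl bg, biformZr bg); ring.
Qed.

Let philin3 a X Y Z Z' : phi X Y (a *: Z + Z') = a * phi X Y Z + phi X Y Z'.
Proof.
have bg := metric_bilinear; have bm := bmu.1.
rewrite /phi /m !mulmxDr -!scalemxAr.
rewrite !(bilDl bm, bilDr bm, bilZl bm, bilZr bm, biformDl bg, biformDr bg,
  biformZl bg, biformZr bg); ring.
Qed.

Let phi_sum X Y Z (e : 'I_(n + n) -> E) : orthonormal_frame g e ->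
  phi X Y Z = \sum_k g (e k) Z * phi X Y (e k).
Proof.
move=> oe; rewrite {1}(frame_expand metric_bilinear oe Z).
have p0 : phi X Y 0 = 0.
  by have := philin3 (- 1) X Y 0 0; rewrite scaler0 addr0 => ->; ring.
elim: (index_enum _) => [|k r IH]; first by rewrite !big_nil.
by rewrite !big_cons philin3 IH.
Qed.

Let D0 X Y := \sum_k (2^-1 * phi X Y (some_frame g k)) *: some_frame g k.

Let g_D0 X Y Z : g (D0 X Y) Z = 2^-1 * phi X Y Z.
Proof.
have bg := metric_bilinear.
rewrite (phi_sum X Y Z some_frameP) mulr_sumr /D0 (biform_suml bg).
by apply: eq_bigr => k _; rewrite (biformZl bg); ring.
Qed.

Lemma metric_inj X Y : (forall Z, g X Z = g Y Z) -> X = Y.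
Proof.
move=> XY; apply/eqP; rewrite -subr_eq0; apply/negP => /negP /metric_gt0.
by rewrite (biformBl metric_bilinear) XY subrr ltxx.
Qed.

Let D0_bismut : is_bismut mu omega D0.
Proof.
have bg := metric_bilinear.
split.
- split=> [Y a X X'|X a Y Y']; apply: metric_inj => Z;
    rewrite (biformDl bg) (biformZl bg) !g_D0.
    by rewrite philin1; ring.
  by rewrite philin2; ring.
- by move=> X Y Z; rewrite (metricC Y) !g_D0 (phi_skew X Z); ring.
- move=> X Y; apply: metric_inj => Z.
  by rewrite metric_Jl !g_D0 phi_J; ring.
(* In the antisymmetrised Koszul formula the terms free of [J] add up to [2 * m Y Z X], cancelled by
   the bracket in the torsion, while the cyclic sum in [J] doubles. *)
- have c X Y Z : g X (torsion mu D0 Y Z) = - (m (J *m X) (J *m Y) Z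
      + m (J *m Y) (J *m Z) X + m (J *m Z) (J *m X) Y).
    rewrite metricC /torsion !(biformBl bg) !g_D0 /phi -/(m Y Z X).
    rewrite (m_skew Y Z) (m_skew (J *m Y) (J *m Z)) (m_skew (J *m Z) (J *m X)).
    rewrite (m_skew (J *m X) (J *m Y)) (m_skew Z X) (m_skew X Y); lra.
  have m0 X Y : m X X Y = 0 by rewrite /m bmu.2 (biform0l bg).
  split=> X Y; rewrite c m0.
  + by rewrite (m_skew (J *m Y)); ring.
  + by rewrite (m_skew (J *m Y)); ring.
  + by rewrite (m_skew (J *m Y)); ring.
Qed.

Lemma is_bismut_unique D D' : is_bismut mu omega D -> is_bismut mu omega D' ->
  D = D'.
Proof.
have bg := metric_bilinear.
move=> [bD sD JD [c1 _ _]] [bD' sD' JD' [c1' _ _]].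
pose b X Y Z := g (D X Y) Z - g (D' X Y) Z.
have b_skew X Y Z : b X Y Z = - b X Z Y.
  rewrite /b; have := sD X Y Z; have := sD' X Y Z.
  rewrite !(metricC Y); lra.
have b_J X Y Z : b X (J *m Y) Z = - b X Y (J *m Z).
  by rewrite /b JD JD' !metric_Jl; ring.
(* The bracket cancels between the two torsions, so their alternation leaves [b X Y X = b Y X X],
   and the right-hand side is zero by skewness. *)
have b_XX X Y : b X X Y = 0.
  have := c1 X Y; have := c1' X Y; rewrite /torsion !(biformBr bg).
  have := b_skew X Y X; have := b_skew Y X X; rewrite /b.
  rewrite !(metricC X (_ _ _)); lra.
have b_skew12 X Y Z : b X Y Z = - b Y X Z.
  have := b_XX (X + Y) Z; have := b_XX X Z; have := b_XX Y Z.
  rewrite /b !(bilDl bD, bilDr bD, bilDl bD', bilDr bD', biformDl bg); lra.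
have b_JJ X Y Z : b X (J *m Y) (J *m Z) = b X Y Z.
  rewrite b_J J0K /b !(biformNr bg); ring.
(* [b] is totally skew, so [b (J X) (J Y) Z] is [- b X Y Z] by [b_J] in the last
   two slots and [b X Y Z] by [b_JJ] after a cyclic permutation. *)
have b0 X Y Z : b X Y Z = 0.
  have := b_skew12 (J *m X) (J *m Y) Z; have := b_J (J *m X) Y Z.
  have := b_skew12 (J *m X) Y (J *m Z); have := b_JJ Y X Z.
  have := b_skew (J *m X) (J *m Y) Z; have := b_skew12 (J *m X) Z (J *m Y).
  have := b_JJ Z X Y; have := b_skew12 Z X Y; have := b_skew X Z Y.
  have := b_skew12 X Y Z; lra.
apply/funext => X; apply/funext => Y; apply: metric_inj => Z.
by apply/eqP; rewrite -subr_eq0; apply/eqP; exact: b0.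
Qed.

Lemma bismutP : is_bismut mu omega (bismut mu omega).
Proof. exact: (@xgetI _ _ [set D | is_bismut mu omega D] D0). Qed.

Lemma bismut_koszul X Y Z : g (bismut mu omega X Y) Z = 2^-1 * phi X Y Z.
Proof. by rewrite (is_bismut_unique bismutP D0_bismut) g_D0. Qed.

Definition ad (Z : E) : 'M[R]_(n + n) := mx_of (mu Z).

Let adE X Y : mu X Y = ad X *m Y. Proof. exact: (bil_mx_of bmu.1). Qed.

Lemma frame_trace_J (e : 'I_(n + n) -> E) (A : 'M[R]_(n + n)) :
  orthonormal_frame g e ->
  \sum_k g (A *m e k) (J *m e k) = - \tr (J *m A).
Proof.
move=> oe; rewrite -(frame_trace metric_bilinear metricC oe) -sumrN.
by apply: eq_bigr => k _; rewrite -mulmxA metric_Jl opprK.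
Qed.

Lemma mx_of_J (f : E -> E) : (forall X, f X = mx_of f *m X) ->
  (forall X, f (J *m X) = J *m f X) -> mx_of f *m J = J *m mx_of f.
Proof.
move=> fE fJ; apply/matrixP => i j.
rewrite -[LHS]unit_vec_sandwich -[RHS]unit_vec_sandwich -!mulmxA.
by rewrite -(fE (unit_vec j)) -fE fJ.
Qed.

Section Ricci.
Variable e : 'I_(n + n) -> E.
Hypothesis oe : orthonormal_frame g e.

Let oJe : orthonormal_frame g (fun k => J *m e k).
Proof. by move=> i j; rewrite metric_JJ. Qed.

(** The Koszul formula is taken at [e k] and [J e k]. Four of its terms have [W] or [J W] inside the
    bracket and sum to traces, one of them over the frame [J e]; the other two coincide and give the
    contraction of [mu(., J .)]. *)
Lemma bismut_trace (W : E) :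
  \sum_k g (bismut mu omega W (e k)) (J *m e k) =
  - (\tr (J *m ad W) + \tr (ad (J *m W)) + \sum_k g (mu (e k) (J *m e k)) W).
Proof.
have bg := metric_bilinear.
have H k : g (bismut mu omega W (e k)) (J *m e k) =
    2^-1 * (g (ad W *m e k) (J *m e k) - g (ad W *m (J *m e k)) (e k)
    - g (ad (J *m W) *m (J *m e k)) (J *m e k)
    - g (ad (J *m W) *m e k) (e k)) - g (mu (e k) (J *m e k)) W.
  rewrite bismut_koszul -!adE /phi J0K mNr mNl.
  rewrite (m_skew (J *m e k) W) (m_skew (J *m e k) (e k)).
  rewrite (m_skew (e k) (J *m W)) /m; lra.
under eq_bigr do rewrite H.
rewrite sumrB -mulr_sumr !sumrB (frame_trace_J _ oe).
under [X in _ - X - _ - _]eq_bigr do rewrite mulmxA.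
rewrite !(frame_trace metric_bilinear metricC oe).
rewrite (frame_trace metric_bilinear metricC oJe) mxtrace_mulC.
by rewrite [\tr (_ *m J)]mxtrace_mulC; field.
Qed.

End Ricci.

Lemma bismut_ricciE (e : 'I_(n + n) -> E) X Y : orthonormal_frame g e ->
  bismut_ricci mu omega X Y = 2^-1 * (\tr (J *m ad (mu X Y))
    + \tr (ad (J *m mu X Y)) + \sum_k g (mu (e k) (J *m e k)) (mu X Y)).
Proof.
move=> oe; have bg := metric_bilinear; have bm := bmu.1.
have [bD _ JD _] := bismutP.
rewrite /bismut_ricci; congr (_ * _); set s := some_frame g.
have os : orthonormal_frame g s := some_frameP.
pose A := mx_of (bismut mu omega X); pose B := mx_of (bismut mu omega Y).
have AJ : A *m J = J *m A by apply: mx_of_J; [exact: (bil_mx_of bD)|exact: JD].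
have BJ : B *m J = J *m B by apply: mx_of_J; [exact: (bil_mx_of bD)|exact: JD].
have H k : g (curvature mu (bismut mu omega) X Y (s k)) (J *m s k) =
    g (A *m B *m s k) (J *m s k) - g (B *m A *m s k) (J *m s k)
    - g (bismut mu omega (mu X Y) (s k)) (J *m s k).
  rewrite /curvature !(biformBl bg) -!mulmxA /A /B.
  by rewrite -!(bil_mx_of bD).
under eq_bigr do rewrite H.
rewrite !sumrB !(frame_trace_J _ os) (bismut_trace os).
have -> : \tr (J *m (B *m A)) = \tr (J *m (A *m B)).
  by rewrite mulmxA -BJ -mulmxA mxtrace_mulC mulmxA.
rewrite subrr sub0r opprK; congr (_ + _).
(* The contraction is the last term that depends on the frame; passing through the inverse Gram
   matrix exchanges [some_frame] for the given [e]. *)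
have bf : bilinear_for *:%R *:%R (fun U V : E => g (mu U (J *m V)) (mu X Y) : R^o).
  split=> [V a U U'|U a V V'] /=.
    by rewrite (bilDl bm) (bilZl bm) (biformDl bg) (biformZl bg).
  by rewrite mulmxDr -scalemxAr (bilDr bm) (bilZr bm) (biformDl bg) (biformZl bg).
have := frame_contract bg oe bf; rewrite /= => ->.
by have := frame_contract bg os bf; rewrite /= => ->.
Qed.

End Metric.
End Bismut.

(** * The standard form, naturality of the Ricci form, and the endomorphism P *)

Section RicciEndomorphism.
Context {R : realType} {n : nat}.
Notation E := (vec R n).
Notation J := (@J0 R n).
Implicit Types (omega : E -> E -> R) (mu : E -> E -> E).

Lemma unit_vecE (i j : 'I_(n + n)) : (unit_vec i : E) j 0 = (i == j)%:R.
Proof. by rewrite !mxE eqxx andbT eq_sym. Qed.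

Lemma inner_bilinear : bilinear_for *%R *%R (@inner R n).
Proof.
split=> [Y a X X'|X a Y Y']; rewrite /inner /= mulr_sumr -big_split /=;
  apply: eq_bigr => i _; rewrite !mxE; ring.
Qed.

Lemma inner_mx (X Y : E) : inner X Y = (X^T *m Y) 0 0.
Proof. by rewrite mxE; apply: eq_bigr => i _; rewrite mxE. Qed.

Lemma trmx_J0 : J^T = - J.
Proof.
by rewrite /J0 tr_block_mx !trmx0 linearN /= trmx1 opp_block_mx oppr0 opprK.
Qed.

Lemma inner_JJ X Y : inner (J *m X) (J *m Y) = inner X Y :> R.
Proof.
by rewrite !inner_mx trmx_mul trmx_J0 mulmxN mulNmx -mulmxA J0K mulmxN opprK.
Qed.

Lemma metric_omega0 : metric omega0 = @inner R n.
Proof. by apply/funext => X; apply/funext => Y; exact: inner_JJ. Qed.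

Lemma omega0_compatible : compatible (@omega0 R n).
Proof.
have bi := inner_bilinear; split.
- split=> [|X].
    split=> [Y a X X'|X a Y Y']; rewrite /omega0 /=.
      by rewrite (biformDl bi) (biformZl bi).
    by rewrite mulmxDr -scalemxAr (biformDr bi) (biformZr bi).
  have sI : inner X (J *m X) = inner (J *m X) X :> R.
    by rewrite /inner; apply: eq_bigr => i _; rewrite mulrC.
  have := inner_JJ X (J *m X); rewrite J0K (biformNr bi) -sI /omega0; lra.
- by move=> X Y; rewrite /omega0 inner_JJ.
- rewrite metric_omega0; split=> //.
    by move=> X Y; rewrite /inner; apply: eq_bigr => i _; rewrite mulrC.
  move=> X X0; rewrite lt_neqAle eq_sym; apply/andP; split; last first.
    by apply: sumr_ge0 => i _; rewrite -expr2 sqr_ge0.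
  apply: contra_neq X0 => /eqP.
  rewrite psumr_eq0 => [/allP H|i _]; last by rewrite -expr2 sqr_ge0.
  apply/matrixP => i j; rewrite (ord1 j) mxE.
  by have := H i (mem_index_enum i); rewrite -expr2 sqrf_eq0 => /eqP.
Qed.

Lemma unit_vec_orthonormal : orthonormal_frame (metric omega0) (@unit_vec R (n + n)).
Proof.
move=> i j; rewrite metric_omega0 /inner (bigD1 i) //= !unit_vecE eqxx mul1r.
rewrite big1 => [|k ki]; first by rewrite addr0 eq_sym.
by rewrite !unit_vecE eq_sym (negbTE ki) mul0r.
Qed.

Lemma metric_pullback h omega : h *m J = J *m h ->
  metric (pullback h omega) = fun X Y => metric omega (h *m X) (h *m Y).
Proof.
move=> hJ; apply/funext => X; apply/funext => Y.
by rewrite /metric /pullback mulmxA hJ mulmxA.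
Qed.

Lemma pullback_compatible h omega : GLC h -> compatible omega ->
  compatible (pullback h omega).
Proof.
move=> [hu hJ] co; have bg := metric_bilinear co; case: (co) => [[bo o0] oJ _].
split.
- split=> [|X]; last exact: o0.
  split=> [Y a X X'|X a Y Y']; rewrite /pullback /= mulmxDr -scalemxAr.
    by rewrite (biformDl bo) (biformZl bo).
  by rewrite (biformDr bo) (biformZr bo).
- by move=> X Y; rewrite /pullback !mulmxA hJ -!mulmxA oJ.
- rewrite metric_pullback //; split.
  + split=> [Y a X X'|X a Y Y'] /=; rewrite mulmxDr -scalemxAr.
      by rewrite (biformDl bg) (biformZl bg).
    by rewrite (biformDr bg) (biformZr bg).
  + move=> X Y /=. exact: (metricC co).
  + move=> X X0; apply: metric_gt0 => //; apply: contra_neq X0 => hX.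
    by rewrite -(mulKmx hu X) hX mulmx0.
Qed.

(** The trace formula is natural term by term: [h] commutes with [J], sends an orthonormal frame of
    the pullback metric to one of the original metric, and conjugates [ad]. The connection itself is
    never transported. *)
Lemma bismut_ricci_natural h omega mu mu' X Y :
  GLC h -> compatible omega ->
  bracket mu -> J0_integrable mu -> bracket mu' -> J0_integrable mu' ->
  (forall X Y, mu' (h *m X) (h *m Y) = h *m mu X Y) ->
  bismut_ricci mu' omega (h *m X) (h *m Y) =
  bismut_ricci mu (pullback h omega) X Y.
Proof.
move=> hG co bmu imu bmu' imu' hmu; have [hu hJ] := hG.
have cp := pullback_compatible hG co.
pose e := some_frame (metric (pullback h omega)).
have oe : orthonormal_frame (metric (pullback h omega)) e by exact: some_frameP.
have ohe : orthonormal_frame (metric omega) (fun k => h *m e k).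
  by move=> i j; rewrite -oe metric_pullback.
rewrite (bismut_ricciE co bmu' imu' _ _ ohe) (bismut_ricciE cp bmu imu _ _ oe).
have adh W : ad mu' (h *m W) = h *m ad mu W *m invmx h.
  apply: (canRL (mulmxK hu)); apply/matrixP => i j.
  rewrite -[LHS]unit_vec_sandwich -[RHS]unit_vec_sandwich -!mulmxA.
  by rewrite -(bil_mx_of bmu.1) -(bil_mx_of bmu'.1) hmu.
have trh A : \tr (h *m A *m invmx h) = \tr A :> R.
  by rewrite mxtrace_mulC mulmxA mulVmx // mul1mx.
have Jh m (U : 'M[R]_(n + n, m)) : J *m (h *m U) = h *m (J *m U).
  by rewrite !mulmxA hJ.
rewrite hmu Jh !adh -[h *m _ *m _]mulmxA Jh !mulmxA -(mulmxA h J) !trh.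
congr (_ * (_ + _)); apply: eq_bigr => k _.
by rewrite metric_pullback // Jh hmu.
Qed.

Lemma bismut_ricci11_natural h omega mu mu' X Y :
  GLC h -> compatible omega ->
  bracket mu -> J0_integrable mu -> bracket mu' -> J0_integrable mu' ->
  (forall X Y, mu' (h *m X) (h *m Y) = h *m mu X Y) ->
  bismut_ricci11 mu' omega (h *m X) (h *m Y) =
  bismut_ricci11 mu (pullback h omega) X Y.
Proof.
move=> hG co bmu imu bmu' imu' hmu; rewrite /bismut_ricci11.
rewrite (bismut_ricci_natural _ _ hG co bmu imu bmu' imu' hmu).
rewrite !mulmxA -hG.2 -!mulmxA.
by rewrite (bismut_ricci_natural _ _ hG co bmu imu bmu' imu' hmu).
Qed.

Section Endo.
Variables (omega : E -> E -> R) (mu : E -> E -> E).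
Hypotheses (co : compatible omega) (bmu : bracket mu) (imu : J0_integrable mu).
Notation g := (metric omega).
Notation rho := (bismut_ricci mu omega).
Notation rho11 := (bismut_ricci11 mu omega).

Let bg := metric_bilinear co.
Let bm := bmu.1.

Let adD a W W' : ad mu (a *: W + W') = a *: ad mu W + ad mu W'.
Proof.
by apply/matrixP => i j; rewrite !mxE (bilDl bm) (bilZl bm) !mxE.
Qed.

(** The trace formula factors the Ricci form as a linear form [theta] applied to the bracket, so
    bilinearity and skewness are inherited from [mu]. *)
Let theta W := 2^-1 * (\tr (J *m ad mu W) + \tr (ad mu (J *m W))
  + \sum_k g (mu (some_frame g k) (J *m some_frame g k)) W).

Let thetaD a W W' : theta (a *: W + W') = a * theta W + theta W'.
Proof.
rewrite /theta mulmxDr -scalemxAr !adD mulmxDr -scalemxAr !mxtraceD !mxtraceZ.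
under [X in _ * (_ + X)]eq_bigr do rewrite (biformDr bg) (biformZr bg).
rewrite big_split -mulr_sumr /=; ring.
Qed.

Let rhoE X Y : rho X Y = theta (mu X Y).
Proof. by rewrite (bismut_ricciE co bmu imu _ _ (some_frameP co)). Qed.

Lemma bismut_ricci11_bilinear : bilinear_for *%R *%R rho11.
Proof.
split=> [Y a X X'|X a Y Y']; rewrite /bismut_ricci11 /= mulmxDr -scalemxAr.
  rewrite !rhoE !(bilDl bm, bilZl bm) !thetaD; ring.
by rewrite !rhoE !(bilDr bm, bilZr bm) !thetaD; ring.
Qed.

Lemma bismut_ricci11_skew X Y : rho11 X Y = - rho11 Y X.
Proof.
have thetaN W : theta (- W) = - theta W.
  have t0 : theta 0 = 0 by have := thetaD (- 1) 0 0; rewrite scaler0 addr0; lra.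
  by have := thetaD (- 1) W 0; rewrite scaleN1r addr0 t0; lra.
rewrite /bismut_ricci11 !rhoE (bracket_skew bmu X).
by rewrite (bracket_skew bmu (J *m X)) !thetaN; ring.
Qed.

Lemma bismut_ricci11_JJ X Y : rho11 (J *m X) (J *m Y) = rho11 X Y.
Proof.
rewrite /bismut_ricci11 !J0K addrC; congr (_ * (_ + _)).
by rewrite !rhoE (bilNl bm) (bilNr bm) opprK.
Qed.

Lemma ricci_endoP X Y : omega (ricci_endo mu omega *m X) Y = rho11 X Y.
Proof.
have b11 := bismut_ricci11_bilinear.
pose e := some_frame g.
(* This vector satisfies [g (p X) Z = - rho11 X (J Z)]; since [omega X Y = g X (J Y)], replacing [Z]
   by [J Z] gives the defining equation of P. *)
pose p X := \sum_k (- rho11 X (J *m e k)) *: e k.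
have pD a U U' : p (a *: U + U') = a *: p U + p U'.
  rewrite /p scaler_sumr -big_split /=; apply: eq_bigr => k _.
  by rewrite (biformDl b11) (biformZl b11) scalerA -scalerDl; congr (_ *: _); ring.
have pE U : p U = mx_of p *m U.
  have p0 : p 0 = 0.
    by rewrite /p big1 // => k _; rewrite (biform0l b11) oppr0 scale0r.
  have psum : p U = \sum_i U i 0 *: p (unit_vec i).
    rewrite {1}(col_sum_unit U).
    by elim: (index_enum _) => [|k r IH]; rewrite ?big_nil // !big_cons pD IH.
  rewrite psum; apply/matrixP => i j; rewrite (ord1 j) !mxE summxE.
  by apply: eq_bigr => k _; rewrite !mxE mulrC.
have gp U Z : g (p U) Z = - rho11 U (J *m Z).
  rewrite {2}(frame_expand bg (some_frameP co) Z) mulmx_sumr (biform_sumr b11).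
  rewrite /p (biform_suml bg) -sumrN; apply: eq_bigr => k _.
  by rewrite (biformZl bg) -scalemxAr (biformZr b11); ring.
have H : [set P : 'M[R]_(n + n) | forall X Y, omega (P *m X) Y = rho11 X Y] (mx_of p).
  move=> U Z; rewrite -pE (omega_metric co) gp J0K (biformNr b11); exact: opprK.
exact: (xgetI _ H X Y).
Qed.

Lemma ricci_endo_unique (P : 'M[R]_(n + n)) :
  (forall X Y, omega (P *m X) Y = rho11 X Y) -> P = ricci_endo mu omega.
Proof.
move=> HP; apply/matrixP => i j.
rewrite -[LHS]unit_vec_sandwich -[RHS]unit_vec_sandwich -!mulmxA.
congr ((_ *m _) 0 0); apply: (metric_inj co) => Z.
have := etrans (HP (unit_vec j) (J *m Z)) (esym (ricci_endoP _ _)).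
by rewrite !(omega_metric co) J0K !(biformNr bg) => /oppr_inj.
Qed.

(** Rests on the [J]-invariance of [rho11], which the (1,1) projection provides. It is what keeps
    the gauge [h] complex linear. *)
Lemma ricci_endo_J : ricci_endo mu omega *m J = J *m ricci_endo mu omega.
Proof.
have b11 := bismut_ricci11_bilinear; have [[bo _] oJ _] := co.
apply/matrixP => i j; rewrite -[LHS]unit_vec_sandwich -[RHS]unit_vec_sandwich.
rewrite -!mulmxA; congr ((_ *m _) 0 0); apply: (metric_inj co) => Z.
have H U V : omega (J *m U) V = - omega U (J *m V).
  by rewrite -oJ J0K (biformNl bo).
have HP := ricci_endoP (J *m unit_vec j) (J *m Z).
rewrite bismut_ricci11_JJ -ricci_endoP in HP.
have := HP; rewrite !(omega_metric co) J0K (biformNr bg) => HP'.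
by rewrite (metric_Jl co) -HP' opprK.
Qed.

Lemma ricci_endo_sym X Y :
  omega (ricci_endo mu omega *m X) Y = omega X (ricci_endo mu omega *m Y).
Proof.
have [[bo o0] _ _] := co.
have skew U V : omega U V = - omega V U.
  have := o0 (U + V); rewrite (biformDl bo) !(biformDr bo) !o0; lra.
by rewrite (skew X) !ricci_endoP bismut_ricci11_skew.
Qed.

End Endo.

(** The conjugate of P by [h] satisfies the equation that characterises P for the pulled-back form,
    so uniqueness applies. *)
Lemma ricci_endo_natural h omega mu mu' :
  GLC h -> compatible omega ->
  bracket mu -> J0_integrable mu -> bracket mu' -> J0_integrable mu' ->
  (forall X Y, mu' (h *m X) (h *m Y) = h *m mu X Y) ->
  ricci_endo mu' omega *m h = h *m ricci_endo mu (pullback h omega).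
Proof.
move=> hG co bmu imu bmu' imu' hmu; have [hu hJ] := hG.
have cp := pullback_compatible hG co.
rewrite -[LHS]mul1mx -(mulmxV hu) -mulmxA; congr (_ *m _).
apply: (ricci_endo_unique cp bmu imu) => X Y.
rewrite /pullback !mulmxA mulmxV // mul1mx -mulmxA (ricci_endoP co bmu' imu').
exact: bismut_ricci11_natural.
Qed.

(** Replaces the chosen endomorphism by explicit values of the Ricci form, from which its continuity
    can be read off. *)
Lemma ricci_endo_omega0E mu i j : bracket mu -> J0_integrable mu ->
  ricci_endo mu omega0 i j =
  - bismut_ricci11 mu omega0 (unit_vec j) (J *m unit_vec i).
Proof.
move=> bmu imu; have co := omega0_compatible.
rewrite -(ricci_endoP co bmu imu) (omega_metric co) J0K.
rewrite (biformNr (metric_bilinear co)) opprK metric_omega0.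
rewrite (_ : inner _ _ = inner (unit_vec i) (ricci_endo mu omega0 *m unit_vec j)).
  by rewrite inner_mx mulmxA unit_vec_sandwich.
by rewrite -metric_omega0 metricC.
Qed.

End RicciEndomorphism.

(** * Dependence on the bracket and on the form *)

Section ContinuousMatrices.
Context {R : realType}.
Implicit Types D : set R.

Lemma continuous_in_det m D (A : R -> 'M[R]_m) :
  (forall i j, continuous_in D (fun s => A s i j)) ->
  continuous_in D (fun s => \det (A s)).
Proof.
move=> cA; apply: continuous_in_sum => p; apply: continuous_inM.
  exact: continuous_in_cst.
by apply: continuous_in_prod => i; exact: cA.
Qed.

Lemma continuous_in_invmx m D (A : R -> 'M[R]_m) :
  (forall i j, continuous_in D (fun s => A s i j)) ->
  (forall t, D t -> A t \in unitmx) ->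
  forall i j, continuous_in D (fun s => invmx (A s) i j).
Proof.
move=> cA uA i j.
apply: (continuous_in_ext (f := fun s => (\det (A s))^-1 * cofactor (A s) j i)).
  by move=> s Ds; rewrite /invmx uA // !mxE.
apply: continuous_inM.
  apply: continuous_inV; last exact: continuous_in_det.
  by move=> t Dt; have := uA t Dt; rewrite unitmxE unitfE.
apply: continuous_inM; first exact: continuous_in_cst.
apply: continuous_in_det => k l.
by under eq_fun do rewrite !mxE; exact: cA.
Qed.

End ContinuousMatrices.

Section Curves.
Context {R : realType} {n : nat}.
Notation E := (vec R n).
Notation J := (@J0 R n).
Implicit Types D : set R.

(** The curve of brackets is controlled only at fixed vectors; expansion in coordinates reduces
    moving arguments to that case. The product rule for brackets below rests on the same
    expansion. *)
Lemma continuous_in_bil D (mu : R -> E -> E -> E) (x y : R -> E) :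
  (forall t, D t -> bilinear_for *:%R *:%R (mu t)) ->
  (forall X Y i, continuous_in D (fun s => mu s X Y i 0)) ->
  (forall i, continuous_in D (fun s => x s i 0)) ->
  (forall i, continuous_in D (fun s => y s i 0)) ->
  forall i, continuous_in D (fun s => mu s (x s) (y s) i 0).
Proof.
move=> bm cm cx cy i.
apply: (continuous_in_ext (f := fun s => \sum_a \sum_b
    x s a 0 * y s b 0 * mu s (unit_vec a) (unit_vec b) i 0)) => [s Ds|].
  rewrite (bil_expand (bm s Ds)) summxE; apply: eq_bigr => a _.
  by rewrite summxE; apply: eq_bigr => b _; rewrite !mxE.
apply: continuous_in_sum => a; apply: continuous_in_sum => b.
by apply: continuous_inM => //; exact: continuous_inM.
Qed.

Lemma has_derivative_in_bil D (mu : R -> E -> E -> E) (x y : R -> E) t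
    (mu' : E -> E -> E) (x' y' : E) : D t ->
  (forall s, D s -> bilinear_for *:%R *:%R (mu s)) ->
  bilinear_for *:%R *:%R mu' ->
  (forall X Y, has_derivative_in D (fun s => mu s X Y) t (mu' X Y)) ->
  has_derivative_in D x t x' -> has_derivative_in D y t y' ->
  has_derivative_in D (fun s => mu s (x s) (y s)) t
    (mu' (x t) (y t) + mu t x' (y t) + mu t (x t) y').
Proof.
move=> Dt bm bm' dm /has_derivative_in_mxP dx /has_derivative_in_mxP dy.
have ex (f : E -> E -> E) : bilinear_for *:%R *:%R f -> forall X Y i j, f X Y i j =
    \sum_a \sum_b X a 0 * Y b 0 * f (unit_vec a) (unit_vec b) i j.
  move=> bf X Y i j; rewrite (bil_expand bf) summxE; apply: eq_bigr => a _.
  by rewrite summxE; apply: eq_bigr => b _; rewrite !mxE.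
apply/has_derivative_in_mxP => i j.
apply: (has_derivative_in_ext (f := fun s => \sum_a \sum_b
    x s a 0 * y s b 0 * mu s (unit_vec a) (unit_vec b) i j)) => // [s Ds|].
  by rewrite [RHS](ex _ (bm s Ds)).
rewrite !mxE (ex _ bm') !(ex _ (bm t Dt)) -!big_split /=.
apply: has_derivative_in_sum => a; rewrite -!big_split /=.
apply: has_derivative_in_sum => b.
have /has_derivative_in_mxP dmi := dm (unit_vec a) (unit_vec b).
rewrite [X in has_derivative_in _ _ _ X](_ : _ =
  (x' a 0 * y t b 0 + x t a 0 * y' b 0) * mu t (unit_vec a) (unit_vec b) i j
  + x t a 0 * y t b 0 * mu' (unit_vec a) (unit_vec b) i j); last by ring.
exact: (has_derivative_inM (has_derivative_inM (dx a 0) (dy b 0)) (dmi i j)).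
Qed.

Lemma has_derivative_in_omega0 D (x y : R -> E) t (x' y' : E) :
  has_derivative_in D x t x' -> has_derivative_in D y t y' ->
  has_derivative_in D (fun s => omega0 (x s) (y s)) t
    (omega0 x' (y t) + omega0 (x t) y').
Proof.
move=> dx dy.
have dJy := has_derivative_in_mulmx (has_derivative_in_mx_cst D J t) dy.
have := has_derivative_in_mulmx (has_derivative_in_trmx dx) dJy.
move/has_derivative_in_mxP/(_ 0 0).
rewrite mul0mx add0r /omega0 !inner_mx mxE.
by under eq_fun do rewrite -inner_mx.
Qed.

(** Here the form stays [omega0], so the trace formula can be used in the constant frame of
    coordinate vectors, where it is polynomial in the values of [mu]. *)
Lemma continuous_in_ricci_endo D (mu : R -> E -> E -> E) :
  (forall t, D t -> bracket (mu t) /\ J0_integrable (mu t)) ->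
  (forall X Y i, continuous_in D (fun s => mu s X Y i 0)) ->
  forall i j, continuous_in D (fun s => ricci_endo (mu s) omega0 i j).
Proof.
move=> hm cm i j.
have bm t (Dt : D t) : bilinear_for *:%R *:%R (mu t) := (hm t Dt).1.1.
have cJ (v : R -> E) : (forall k, continuous_in D (fun s => v s k 0)) ->
    forall k, continuous_in D (fun s => (J *m v s) k 0).
  move=> cv k; under eq_fun do rewrite mxE.
  apply: continuous_in_sum => l; apply: continuous_inM => //.
  exact: continuous_in_cst.
have crho X Y : continuous_in D (fun s => bismut_ricci (mu s) omega0 X Y).
  pose W s := mu s X Y.
  apply: (continuous_in_ext (f := fun s => 2^-1 * (
      \sum_k (J *m mu s (W s) (unit_vec k)) k 0
      + \sum_k mu s (J *m W s) (unit_vec k) k 0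
      + \sum_k \sum_l mu s (unit_vec k) (J *m unit_vec k) l 0 * W s l 0))).
    move=> s Ds; have [bs ims] := hm s Ds.
    rewrite (bismut_ricciE omega0_compatible bs ims _ _ unit_vec_orthonormal).
    congr (_ * (_ + _ + _)).
    - apply: eq_bigr => k _; rewrite !mxE; apply: eq_bigr => l _.
      by rewrite !mxE.
    - by apply: eq_bigr => k _; rewrite !mxE.
    - by apply: eq_bigr => k _; rewrite metric_omega0.
  have cW := cm X Y.
  have cu k l : continuous_in D (fun=> (unit_vec k : E) l 0).
    exact: continuous_in_cst.
  apply: continuous_inM; first exact: continuous_in_cst.
  apply: continuous_inD; first apply: continuous_inD.
  - by apply: continuous_in_sum => k; apply: cJ; exact: continuous_in_bil.
  - by apply: continuous_in_sum => k; apply: continuous_in_bil => //; exact: cJ.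
  - apply: continuous_in_sum => k; apply: continuous_in_sum => l.
    by apply: continuous_inM; [exact: cm|exact: cW].
apply: (continuous_in_ext (f := fun s =>
    - bismut_ricci11 (mu s) omega0 (unit_vec j) (J *m unit_vec i))) => [s Ds|].
  by have [bs ims] := hm s Ds; rewrite ricci_endo_omega0E.
apply: continuous_inN; apply: continuous_inM; first exact: continuous_in_cst.
exact: continuous_inD.
Qed.

(** * Comparison of the Ricci forms along two curves of forms *)

Section Lipschitz.
Variables (a b : R) (mu : E -> E -> E) (w w' : R -> E -> E -> R).
Hypotheses (ab : a <= b) (bmu : bracket mu) (imu : J0_integrable mu).
Notation D := (`[a, b]%classic : set R).
Hypothesis cw : forall s, a <= s <= b -> compatible (w s).
Hypothesis cw' : forall s, a <= s <= b -> compatible (w' s).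
Hypothesis kw :
  forall i j, continuous_in D (fun s => w s (unit_vec i) (unit_vec j)).
Hypothesis kw' :
  forall i j, continuous_in D (fun s => w' s (unit_vec i) (unit_vec j)).

Let dist s := \sum_p `|w s (unit_vec p.1) (unit_vec p.2)
  - w' s (unit_vec p.1) (unit_vec p.2)|.

(** A class closed under sums and under multiplication by continuous functions. A difference is thus
    bounded as soon as it is written through differences of entries, and the constants stay
    implicit. *)
Let dominated (c : R -> R) := exists2 M : R, 0 <= M &
  forall s, a <= s <= b -> `|c s| <= M * dist s.

Let dominated_ext c d : (forall s, a <= s <= b -> c s = d s) ->
  dominated c -> dominated d.
Proof. by move=> cd [M M0 H]; exists M => // s sab; rewrite -cd // H. Qed.

Let dominatedD c d : dominated c -> dominated d ->
  dominated (fun s => c s + d s).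
Proof.
move=> [M M0 HM] [N N0 HN]; exists (M + N); first exact: addr_ge0.
move=> s sab; rewrite mulrDl (le_trans (ler_normD _ _)) // lerD //.
  exact: HM.
exact: HN.
Qed.

Let dominatedM f c : continuous_in D f -> dominated c ->
  dominated (fun s => f s * c s).
Proof.
move=> /(continuous_in_bounded ab)[B B0 HB] [M M0 HM].
exists (B * M); first exact: mulr_ge0.
move=> s sab; rewrite normrM -mulrA; apply: ler_pM => //; first exact: HB.
exact: HM.
Qed.

Let dominated_sum (T : finType) (c : T -> R -> R) :
  (forall i, dominated (c i)) -> dominated (fun s => \sum_i c i s).
Proof.
move=> dc; elim: (index_enum T) => [|i r IH].
  exists 0 => // s _; by rewrite big_nil normr0 mul0r.
under eq_fun do rewrite big_cons.
exact: dominatedD.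
Qed.

Let bil_w s : a <= s <= b -> bilinear_for *%R *%R (w s).
Proof. by case/cw => -[]. Qed.
Let bil_w' s : a <= s <= b -> bilinear_for *%R *%R (w' s).
Proof. by case/cw' => -[]. Qed.

Let form_diff X Y : dominated (fun s => w s X Y - w' s X Y).
Proof.
apply: (@dominated_ext (fun s => \sum_i \sum_j X i 0 * Y j 0 *
    (w s (unit_vec i) (unit_vec j) - w' s (unit_vec i) (unit_vec j)))).
  move=> s sab; rewrite (biform_expand (bil_w sab) X Y).
  rewrite (biform_expand (bil_w' sab) X Y) -sumrB; apply: eq_bigr => i _.
  by rewrite -sumrB; apply: eq_bigr => j _; rewrite mulrBr.
apply: dominated_sum => i; apply: dominated_sum => j; apply: dominatedM.
  exact: continuous_in_cst.
exists 1 => // s sab; rewrite mul1r /dist (bigD1 (i, j)) //= lerDl.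
exact: sumr_ge0.
Qed.

Let metric_diff (X Y : E) : dominated (fun s => metric (w s) X Y - metric (w' s) X Y).
Proof. exact: form_diff. Qed.

Let cont_form (v : R -> E -> E -> R) X Y :
  (forall s, a <= s <= b -> bilinear_for *%R *%R (v s)) ->
  (forall i j, continuous_in D (fun s => v s (unit_vec i) (unit_vec j))) ->
  continuous_in D (fun s => v s X Y).
Proof.
move=> bv cv; apply: (continuous_in_ext (f := fun s => \sum_i \sum_j
    X i 0 * Y j 0 * v s (unit_vec i) (unit_vec j))) => [s|].
  by rewrite /= in_itv /= => sab; rewrite [RHS](biform_expand (bv s sab)).
apply: continuous_in_sum => i; apply: continuous_in_sum => j.
by apply: continuous_inM => //; exact: continuous_in_cst.
Qed.

Let S s := invmx (gram (metric (w s))).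
Let S' s := invmx (gram (metric (w' s))).

Let gram_unitmx (v : E -> E -> R) : compatible v -> gram (metric v) \in unitmx.
Proof.
move=> cv; exact: (gram_unit (metric_bilinear cv) (some_frameP cv)).
Qed.

Let cont_S (v : R -> E -> E -> R) :
  (forall s, a <= s <= b -> compatible (v s)) ->
  (forall i j, continuous_in D (fun s => v s (unit_vec i) (unit_vec j))) ->
  forall i j, continuous_in D (fun s => invmx (gram (metric (v s))) i j).
Proof.
move=> cv kv; apply: continuous_in_invmx => [i j|t].
  apply: (continuous_in_ext
    (f := fun s => metric (v s) (unit_vec i) (unit_vec j))) => [s _|].
    by rewrite mxE.
  by apply: (cont_form (v := v)) => // s /cv [[]].
by rewrite /= in_itv /= => /cv /gram_unitmx.
Qed.

(** The resolvent identity [S - S' = - S (G - G') S'] for inverse Gram matrices expresses the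
    difference of the inverses linearly in that of the metrics. *)
Let S_diff i j : dominated (fun s => S s i j - S' s i j).
Proof.
apply: (@dominated_ext (fun s => \sum_k \sum_l - S s i l * S' s k j *
    (metric (w s) (unit_vec l) (unit_vec k)
     - metric (w' s) (unit_vec l) (unit_vec k)))).
  move=> s sab; have u := gram_unitmx (cw sab); have u' := gram_unitmx (cw' sab).
  have SE : S s - S' s =
      - (S s *m (gram (metric (w s)) - gram (metric (w' s))) *m S' s).
    rewrite mulmxBr mulmxBl /S mulVmx // mul1mx -mulmxA /S' mulmxV // mulmx1.
    by rewrite opprB.
  transitivity ((S s - S' s) i j); last by rewrite !mxE.
  rewrite SE !mxE -sumrN; apply: eq_bigr => k _.
  rewrite !mxE mulr_suml -sumrN; apply: eq_bigr => l _; rewrite !mxE; ring.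
apply: dominated_sum => k; apply: dominated_sum => l; apply: dominatedM => //.
apply: continuous_inM; last exact: cont_S.
by apply: continuous_inN; exact: cont_S.
Qed.

(** [some_frame] need not vary continuously with the form, whereas the inverse Gram matrix does. *)
Let ricci_contract (v : E -> E -> R) X Y : compatible v -> bismut_ricci mu v X Y =
  2^-1 * (\tr (J *m ad mu (mu X Y)) + \tr (ad mu (J *m mu X Y)) +
    \sum_i \sum_j invmx (gram (metric v)) i j *
      metric v (mu (unit_vec i) (J *m unit_vec j)) (mu X Y)).
Proof.
move=> cv; have bg := metric_bilinear cv; have bm := bmu.1.
rewrite (bismut_ricciE cv bmu imu _ _ (some_frameP cv)); congr (_ * (_ + _)).
apply: (@frame_contract _ _ _ bg _ (some_frameP cv) R^o
  (fun U V : E => metric v (mu U (J *m V)) (mu X Y))).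
split=> [V c U U'|U c V V'] /=.
  by rewrite (bilDl bm) (bilZl bm) (biformDl bg) (biformZl bg).
by rewrite mulmxDr -scalemxAr (bilDr bm) (bilZr bm) (biformDl bg) (biformZl bg).
Qed.

(** The two traces involve the bracket but not the form, so they cancel; the contraction is split as
    for the difference of two products. *)
Let ricci_diff X Y :
  dominated (fun s => bismut_ricci mu (w s) X Y - bismut_ricci mu (w' s) X Y).
Proof.
pose A i j := mu (unit_vec i) (J *m unit_vec j).
apply: (@dominated_ext (fun s => 2^-1 * \sum_i \sum_j
   (S s i j * (metric (w s) (A i j) (mu X Y) - metric (w' s) (A i j) (mu X Y))
   + metric (w' s) (A i j) (mu X Y) * (S s i j - S' s i j)))).
  move=> s sab; rewrite (ricci_contract _ _ (cw sab)) (ricci_contract _ _ (cw' sab)) -mulrBr.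
  congr (_ * _).
  rewrite opprD addrACA subrr add0r -sumrB; apply: eq_bigr => i _.
  rewrite -sumrB; apply: eq_bigr => j _; rewrite /S /S' /A; ring.
apply: dominatedM; first exact: continuous_in_cst.
apply: dominated_sum => i; apply: dominated_sum => j; apply: dominatedD.
  by apply: dominatedM; [exact: cont_S|exact: metric_diff].
apply: dominatedM; last exact: S_diff.
exact: cont_form.
Qed.

Lemma bismut_ricci11_lipschitz : exists2 M : R, 0 <= M &
  forall i j s, a <= s <= b ->
    `|bismut_ricci11 mu (w s) (unit_vec i) (unit_vec j)
      - bismut_ricci11 mu (w' s) (unit_vec i) (unit_vec j)|
    <= M * \sum_p `|w s (unit_vec p.1) (unit_vec p.2)
                    - w' s (unit_vec p.1) (unit_vec p.2)|.
Proof.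
have H i j : dominated (fun s =>
    bismut_ricci11 mu (w s) (unit_vec i) (unit_vec j)
    - bismut_ricci11 mu (w' s) (unit_vec i) (unit_vec j)).
  apply: (@dominated_ext (fun s => 2^-1 * (
    (bismut_ricci mu (w s) (unit_vec i) (unit_vec j)
     - bismut_ricci mu (w' s) (unit_vec i) (unit_vec j)) +
    (bismut_ricci mu (w s) (J *m unit_vec i) (J *m unit_vec j)
     - bismut_ricci mu (w' s) (J *m unit_vec i) (J *m unit_vec j))))).
    by move=> s _; rewrite /bismut_ricci11; ring.
  apply: dominatedM; first exact: continuous_in_cst.
  exact: dominatedD.
exists (\sum_i \sum_j projT1 (cid2 (H i j))).
  by apply: sumr_ge0 => i _; apply: sumr_ge0 => j _; case: (cid2 _).
move=> i j s sab; rewrite -/(dist s).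
rewrite (bigD1 i) //= (bigD1 j) //= -addrA mulrDl.
case: (cid2 (H i j)) => /= B B0 /(_ s sab) AB; rewrite ler_wpDr //.
rewrite mulr_ge0 ?sumr_ge0 // addr_ge0 //; apply: sumr_ge0 => k _; first by case: (cid2 _).
by apply: sumr_ge0 => l _; case: (cid2 _).
Qed.

End Lipschitz.
End Curves.

(** * The two flows *)

Section Flows.
Context {R : realType} {n : nat}.
Notation E := (vec R n).
Notation J := (@J0 R n).

(** * The gauge along the bracket flow *)

Section BracketFlow.
Variables (mu0 : E -> E -> E) (K : set R) (mu : R -> E -> E -> E).
Hypotheses (iK : is_interval K) (K0 : K 0) (fmu : bracket_flow mu0 K mu).
Notation P := (fun t => ricci_endo (mu t) omega0).

Let hmu t : K t -> bracket (mu t) /\ J0_integrable (mu t).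
Proof. by case: fmu => _ H _ /H []. Qed.

Let cP i j : continuous_in K (fun s => P s i j).
Proof.
apply: continuous_in_ricci_endo => // X Y k t Kt; case: fmu => _ _ dmu.
have /has_derivative_in_mxP dm := dmu t Kt X Y.
exact: has_derivative_in_continuous (dm k 0).
Qed.

Lemma bracket_flow_gauge : exists h : R -> 'M[R]_(n + n),
  [/\ h 0 = 1%:M,
      forall t, K t -> GLC (h t),
      forall t, K t ->
        has_derivative_in K h t (- (2^-1 *: (P t *m h t)))
    & forall t, K t -> forall X Y, mu t (h t *m X) (h t *m Y) = h t *m mu0 X Y].
Proof.
have c2 D (c : R) f : continuous_in D f -> continuous_in D (fun s => c * f s).
  by move=> cf; apply: continuous_inM => //; exact: continuous_in_cst.
have cA i j : continuous_in K (fun s => (- 2^-1 *: P s) i j).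
  by under eq_fun do rewrite mxE; exact: c2.
have cB i j : continuous_in K (fun s => (2^-1 *: (P s)^T) i j).
  by under eq_fun do rewrite !mxE; exact: c2.
have [h h0 dh'] := mx_linear_ode_exists (1%:M : 'M[R]_(n + n)) iK K0 cA.
(* The equation for [k] has its coefficient on the right, so its transpose [kT] is solved for. *)
have [kT k0 dk'] := mx_linear_ode_exists (1%:M : 'M[R]_(n + n)) iK K0 cB.
pose k t := (kT t)^T.
have dh t : K t -> has_derivative_in K h t (- (2^-1 *: (P t *m h t))).
  by move=> Kt; have := dh' t Kt; rewrite scaleNr mulNmx -scalemxAl.
have dk t : K t -> has_derivative_in K k t (2^-1 *: (k t *m P t)).
  move=> Kt; have := has_derivative_in_trmx (dk' t Kt).
  by rewrite -scalemxAl linearZ /= trmx_mul trmxK.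
have kh t : K t -> k t *m h t = 1%:M.
  move=> Kt; rewrite (@mx_derivative0_cst _ _ _ _ (fun s => k s *m h s) iK K0) //.
    by rewrite /k k0 trmx1 mul1mx h0.
  move=> s Ks; have := has_derivative_in_mulmx (dk s Ks) (dh s Ks).
  by rewrite mulmxN -scalemxAl -scalemxAr mulmxA subrr.
have PJ t : K t -> P t *m J = J *m P t.
  by case/hmu => bm im; exact: (ricci_endo_J omega0_compatible bm im).
have hJ t : K t -> h t *m J = J *m h t.
  move=> Kt; apply/eqP; rewrite -subr_eq0; apply/eqP.
  (* As P commutes with [J], the commutator of [h] with [J] solves the same linear equation as [h],
     with initial value zero. *)
  apply: (@mx_linear_ode_unique _ _ _ _ _ (fun s => h s *m J - J *m h s) iK K0 cA).
  - by rewrite h0 mul1mx mulmx1 subrr.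
  - move=> s Ks; have cJ := has_derivative_in_mx_cst K J s.
    have := has_derivative_in_mxB (has_derivative_in_mulmx (dh s Ks) cJ)
      (has_derivative_in_mulmx cJ (dh s Ks)).
    rewrite mul0mx mulmx0 addr0 add0r mulmxBr.
    rewrite !scaleNr !mulNmx mulmxN -!scalemxAl -scalemxAr !mulmxA.
    by rewrite (PJ s Ks).
  - exact: Kt.
have dmu t : K t -> forall X Y, has_derivative_in K (fun s => mu s X Y) t
    (2^-1 *: delta (mu t) (P t) X Y) by case: fmu => _ _; exact.
have mu00 : mu 0 = mu0 by case: fmu.
exists h; split=> // [t Kt|t Kt X Y].
  split; last exact: hJ.
  by have [] := mulmx1_unit (kh t Kt).
suff H : k t *m mu t (h t *m X) (h t *m Y) = mu0 X Y.
  by rewrite -H mulmxA (mulmx1C (kh t Kt)) mul1mx.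
rewrite (@mx_derivative0_cst _ _ _ _
  (fun s => k s *m mu s (h s *m X) (h s *m Y)) iK K0) //.
  by rewrite /k k0 trmx1 !mul1mx h0 !mul1mx mu00.
move=> s Ks; have [[bm _] _] := hmu Ks.
have dhX (Z : E) : has_derivative_in K (fun r => h r *m Z) s
    (- (2^-1 *: (P s *m (h s *m Z)))).
  have := has_derivative_in_mulmx (dh s Ks) (has_derivative_in_mx_cst K Z s).
  by rewrite mulmx0 addr0 mulNmx -scalemxAl mulmxA.
have bd : bilinear_for *:%R *:%R
    (fun U V : E => 2^-1 *: delta (mu s) (P s) U V).
  split=> [V c U U'|U c V V']; rewrite /delta /= mulmxDr -scalemxAr.
    rewrite !(bilDl bm, bilZl bm) mulmxDr -scalemxAr.
    move: (P s *m mu s U V) (P s *m mu s U' V) => M M'.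
    by apply/matrixP => i j; rewrite !mxE; ring.
  rewrite !(bilDr bm, bilZr bm) mulmxDr -scalemxAr.
  move: (P s *m mu s U V) (P s *m mu s U V') => M M'.
  by apply/matrixP => i j; rewrite !mxE; ring.
have dm := has_derivative_in_bil Ks (fun r Kr => (hmu Kr).1.1) bd (dmu s Ks)
  (dhX X) (dhX Y).
have := has_derivative_in_mulmx (dk s Ks) dm.
rewrite /delta (bilNl bm) (bilNr bm) (bilZl bm) (bilZr bm).
set C := mu s (h s *m X) (h s *m Y).
set A := mu s _ (h s *m Y); set B := mu s (h s *m X) _.
(* The derivatives of the two arguments cancel the first two summands of [delta]. The remaining
   [- P C / 2] is cancelled by the derivative of [k]. *)
rewrite (_ : _ + - _ + - _ = - (2^-1 *: (P s *m C))); last first.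
  by move: (P s *m C) => M; apply/matrixP => i j; rewrite !mxE; ring.
by rewrite mulmxN -scalemxAr -scalemxAl mulmxA subrr.
Qed.

End BracketFlow.

(** The entries on coordinate vectors are compared by Gronwall's lemma on the segment from 0 to [t].
    The constant comes from compactness of that segment and may depend on [t], so each [t] is
    treated separately. *)
Lemma form_flow_unique (mu0 : E -> E -> E) (L : set R)
    (omega omega' : R -> E -> E -> R) :
  is_interval L -> L 0 -> bracket mu0 -> J0_integrable mu0 ->
  form_flow mu0 L omega -> form_flow mu0 L omega' ->
  forall t, L t -> omega t = omega' t.
Proof.
move=> iL L0 bmu imu [w0 cw dw] [w0' cw' dw'] t Lt.
have [a0 b0 tab sL] := segment0_sub iL L0 Lt.
set a := Num.min t 0 in a0 tab *; set b := Num.max t 0 in b0 tab *.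
have Ls s : a <= s <= b -> L s.
  by move=> sab; apply: sL; rewrite /segment0 /= in_itv.
have kont (w : R -> E -> E -> R) (v : R -> E -> E -> R) :
    (forall s, L s -> forall X Y,
      has_derivative_in L (fun r => w r X Y) s (v s X Y)) ->
    forall i j, continuous_in `[a, b] (fun s => w s (unit_vec i) (unit_vec j)).
  move=> H i j; apply: (continuous_in_sub sL) => s Ls'.
  exact: has_derivative_in_continuous (H s Ls' _ _).
have [M M0 HM] := bismut_ricci11_lipschitz (le_trans a0 b0) bmu imu
  (fun s sab => cw s (Ls s sab)) (fun s sab => cw' s (Ls s sab))
  (kont _ _ dw) (kont _ _ dw').
have z := @gronwall _ ('I_(n + n) * 'I_(n + n))%type _ _ a0 b0 M
  (fun p s => omega s (unit_vec p.1) (unit_vec p.2)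
    - omega' s (unit_vec p.1) (unit_vec p.2))
  (fun p s => - bismut_ricci11 mu0 (omega s) (unit_vec p.1) (unit_vec p.2)
    - - bismut_ricci11 mu0 (omega' s) (unit_vec p.1) (unit_vec p.2)) M0.
have {}z p : omega t (unit_vec p.1) (unit_vec p.2) =
    omega' t (unit_vec p.1) (unit_vec p.2).
  apply/eqP; rewrite -subr_eq0; apply/eqP; apply: (z _ _ _ p t tab).
  - by move=> q; rewrite w0 w0' subrr.
  - move=> q s sab; apply: (has_derivative_in_sub sL).
    by apply: has_derivative_inB; [apply: dw|apply: dw']; exact: Ls.
  - by move=> q s sab; rewrite -opprD normrN; exact: HM.
have [[bw _] _ _] := cw t Lt; have [[bw' _] _ _] := cw' t Lt.
apply/funext => X; apply/funext => Y.
rewrite (biform_expand bw) (biform_expand bw'); apply: eq_bigr => i _.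
by apply: eq_bigr => j _; rewrite (z (i, j)).
Qed.

End Flows.

Theorem theorem4p2 (R : realType) (n : nat)
  (mu0 : vec R n -> vec R n -> vec R n) (hmu0 : complex_lie_brackets mu0)
  (I : set R) (hI : is_interval I) (hI0 : I 0)
  (omega : R -> vec R n -> vec R n -> R) (homega : form_flow mu0 I omega)
  (K : set R) (hK : is_interval K) (hK0 : K 0)
  (mu : R -> vec R n -> vec R n -> vec R n) (hmu : bracket_flow mu0 K mu) :
  exists h : R -> 'M[R]_(n + n),
    forall t, (I `&` K) t ->
      [/\ GLC (h t),
          omega t = pullback (h t) omega0,
          mu t = act (h t) mu0,
          has_derivative_in (I `&` K) h t
            (- (2^-1 *: (h t *m ricci_endo mu0 (omega t))))
        & - (2^-1 *: (h t *m ricci_endo mu0 (omega t)))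
            = - (2^-1 *: (ricci_endo (mu t) omega0 *m h t))].
Proof.
have [bmu0 _ imu0] := hmu0; have c0 := @omega0_compatible R n.
have [h [h0 hG dh hmu_eq]] := bracket_flow_gauge hK hK0 hmu.
have iL : is_interval (I `&` K).
  by move=> x y [Ix Kx] [Iy Ky] z xyz; split; [exact: hI xyz|exact: hK xyz].
have [_ cmu _] := hmu; have [w0 cw dw] := homega.
have hf t : (I `&` K) t -> omega t = pullback (h t) omega0.
  apply: (form_flow_unique (omega' := fun s => pullback (h s) omega0)
    iL (conj hI0 hK0) bmu0 imu0).
    split=> [//|s [Is _]|s [Is _] X Y]; first exact: cw.
    by apply: has_derivative_in_sub (dw s Is X Y) => r [].
  split=> [|s [_ Ks]|s [_ Ks] X Y].
  - by apply/funext => X; apply/funext => Y; rewrite /pullback h0 !mul1mx.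
  - by apply: pullback_compatible => //; exact: hG.
  - have gs := hG s Ks; have [bs _ ims] := cmu s Ks.
    have dhX (Z : vec R n) : has_derivative_in K (fun r => h r *m Z) s
        (- (2^-1 *: (ricci_endo (mu s) omega0 *m (h s *m Z)))).
      have := has_derivative_in_mulmx (dh s Ks) (has_derivative_in_mx_cst K Z s).
      by rewrite mulmx0 addr0 mulNmx -scalemxAl mulmxA.
    apply: (has_derivative_in_sub (D := K)) => [r []//|].
    have := has_derivative_in_omega0 (dhX X) (dhX Y).
    rewrite -(bismut_ricci11_natural _ _ gs c0 bmu0 imu0 bs ims (hmu_eq s Ks)).
    have [[b0 _] _ _] := c0.
    rewrite (biformNl b0) (biformNr b0) (biformZl b0) (biformZr b0).
    rewrite -(ricci_endo_sym c0 bs ims) (ricci_endoP c0 bs ims).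
    by congr has_derivative_in; lra.
exists h => t Lt; have [It Kt] := Lt; have gt := hG t Kt.
have [bt _ imt] := cmu t Kt.
(* Naturality applies once [omega t] is known to be the pullback. This identity equates the two
   expressions for the derivative of [h] and lets either be obtained from the other. *)
have Peq : ricci_endo (mu t) omega0 *m h t = h t *m ricci_endo mu0 (omega t).
  by rewrite (hf t Lt); apply: ricci_endo_natural => //; exact: hmu_eq.
split=> //; first exact: hf.
- apply/funext => X; apply/funext => Y; rewrite /act -hmu_eq //.
  by rewrite !mulKVmx //; case: gt.
- by rewrite -Peq; apply: has_derivative_in_sub (dh t Kt) => r [].
- by rewrite Peq.
Qed.
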